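(* Let $\lambda>0$. For every uniform mesh $\mathcal{T}$ of $\Omega=(0,1)\times(0,1)$ of step $h$ with $1/h$ an even positive integer, and every $\boldsymbol{f}\in L^2(\Omega)^2$, there exists a unique pair $(\boldsymbol{u},p)\in X_{\mathcal{T}}^2\times\bar X_{\mathcal{T}}$ such that, for all $K\in\mathcal{T}$, $$(-\Delta_{\mathcal{T}}\boldsymbol{u})_K+(\nabla_{\mathcal{T}}p)_K=\boldsymbol{f}_K,\qquad (\mathrm{div}_{\mathcal{T}}\boldsymbol{u})_K+\lambda\,h^2\,(-\Delta_{S,+}\,p)_K=0.$$ Moreover, there exists a real number $c$ independent of $h$ (and of $\boldsymbol{f}$) such that this solution satisfies $$\|\boldsymbol{u}\|_{\mathcal{T}}+\|p\|_{L^2(\Omega)}\le c\,\|\boldsymbol{f}\|_{L^2(\Omega)^2}.$$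
   Context: Let $\Omega=(0,1)\times(0,1)$. For $h>0$ with $1/h$ an even positive integer, $\mathcal{T}$ is the uniform structured mesh of $\Omega$ made of the $h^{-2}$ square control volumes (cells) of side $h$. $\mathcal{E}_{\rm int}$ (resp. $\mathcal{E}_{\rm ext}$) is the set of internal edges (resp. edges on $\partial\Omega$), $\mathcal{E}(K)$ is the set of the edges of the cell $K$; $\sigma=K|L$ denotes the common edge of two neighbouring cells $K$ and $L$, and $\boldsymbol{n}_{K|L}$ is the unit normal to $K|L$ oriented from $K$ to $L$. For $\sigma\in\mathcal{E}_{\rm ext}$, $\boldsymbol{n}_\sigma$ is the unit normal to $\sigma$ outward $\Omega$. Since $1/h$ is even, $\mathcal{T}$ is partitioned into square $2\times2$ patches of cells, called clusters. $\mathcal{E}_{\rm int}^{+}\subset\mathcal{E}_{\rm int}$ is the set of internal edges separating two cells of the same cluster. $X_{\mathcal{T}}\subset L^2(\Omega)$ is the space of functions which are constant over each cell, $v_K$ denotes the value of $v\in X_{\mathcal{T}}$ on $K$, and $\bar X_{\mathcal{T}}$ is the subspace of functions of $X_{\mathcal{T}}$ with zero mean value over $\Omega$. Discrete $H^1$ norm: for $v\in X_{\mathcal{T}}$, $$\|v\|_{\mathcal{T}}^2=\sum_{\sigma=K|L\in\mathcal{E}_{\rm int}}(v_K-v_L)^2+\sum_{\sigma\in\mathcal{E}_{\rm ext},\,\sigma\in\mathcal{E}(K)}2\,v_K^2,$$ and for $\boldsymbol{v}=(v^{(1)},v^{(2)})\in X_{\mathcal{T}}^2$, $\|\boldsymbol{v}\|_{\mathcal{T}}^2=\|v^{(1)}\|_{\mathcal{T}}^2+\|v^{(2)}\|_{\mathcal{T}}^2$.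 Discrete operators: for $\boldsymbol{u}\in X_{\mathcal{T}}^2$, $p\in X_{\mathcal{T}}$ and $K\in\mathcal{T}$ (sums indexed by $\sigma=K|L$ run over the internal edges of $K$), $$(-\Delta_{\mathcal{T}}\boldsymbol{u})_K=\frac1{h^2}\sum_{\sigma=K|L}(\boldsymbol{u}_K-\boldsymbol{u}_L)+\frac2{h^2}\sum_{\sigma\in\mathcal{E}(K)\cap\mathcal{E}_{\rm ext}}\boldsymbol{u}_K,$$ $$(\nabla_{\mathcal{T}} p)_K=\frac1{h^2}\sum_{\sigma=K|L}h\,\frac{p_K+p_L}{2}\,\boldsymbol{n}_{K|L}+\frac1{h^2}\sum_{\sigma\in\mathcal{E}(K)\cap\mathcal{E}_{\rm ext}}h\,p_K\,\boldsymbol{n}_\sigma,$$ $$(\mathrm{div}_{\mathcal{T}}\boldsymbol{u})_K=\frac1{h^2}\sum_{\sigma=K|L}h\,\frac{\boldsymbol{u}_K+\boldsymbol{u}_L}{2}\cdot\boldsymbol{n}_{K|L},\qquad (-\Delta_{S,+}\,p)_K=\frac1{h^2}\sum_{\sigma=K|L,\ \sigma\in\mathcal{E}_{\rm int}^{+}}(p_K-p_L).$$ $\boldsymbol{f}_K$ denotes the mean value of $\boldsymbol{f}$ over $K$. The parameter $\lambda$ is fixed independently of $h$; the constant $c$ may depend on $\lambda$. *)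

(* Defs.v *)
From HB Require Import structures.
From mathcomp Require Import all_boot all_order all_algebra.
From mathcomp Require Import all_classical all_reals all_analysis.
Set Implicit Arguments.
Unset Strict Implicit.
Unset Printing Implicit Defensive.
Import Order.TTheory GRing.Theory Num.Theory.
Import numFieldNormedType.Exports.
Local Open Scope classical_set_scope.
Local Open Scope ring_scope.

(** The integer n is 1/h, the number of cells per direction.  Directions are elements of
    'I_2: 0 is the horizontal axis and 1 the vertical axis. *)

Definition coord (T : Type) (x : T * T) (d : 'I_2) : T :=
  if d == ord0 then x.1 else x.2.

Definition cell (n : nat) : finType := ('I_n * 'I_n)%type.

Definition step (R : realType) (n : nat) : R := n%:R^-1.

Definition Omega (R : realType) : set (R * R) := `]0, 1[ `*` `]0, 1[.
Arguments Omega R : clear implicits.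

Definition cell_set (R : realType) (n : nat) (K : cell n) : set (R * R) :=
  let h := step R n in
  `](K.1%:R * h), (K.1.+1%:R * h)[ `*` `](K.2%:R * h), (K.2.+1%:R * h)[.
Arguments cell_set R {n} K.

(** A cell K has four edges, one for each pair s = (d, b): the edge orthogonal
    to the axis d which lies on the side of increasing (b = true) or decreasing
    (b = false) d-th coordinate.  An internal edge s of K is the edge K|L for
    the unique L such that [across s K L]. *)

Definition side : finType := ('I_2 * bool)%type.

Definition across (n : nat) (s : side) (K L : cell n) : bool :=
  [forall d : 'I_2,
     if d == s.1 then
       if s.2 then coord L d == (coord K d).+1 :> nat
              else coord K d == (coord L d).+1 :> nat
     else coord L d == coord K d].

Definition external (n : nat) (s : side) (K : cell n) : bool :=
  if s.2 then (coord K s.1).+1 == n else coord K s.1 == 0%N :> nat.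

(** d-th component of the unit normal to the edge s of K, outward K; it is
    n_{K|L} if [across s K L] and n_sigma if the edge is external. *)
Definition normal (R : realType) (s : side) (d : 'I_2) : R :=
  if d == s.1 then (if s.2 then 1 else -1) else 0.

Definition same_cluster (n : nat) (K L : cell n) : bool :=
  [forall d : 'I_2, (coord K d)./2 == (coord L d)./2].

(** A function constant over each cell is given by its values on the cells. *)

Definition XT (R : realType) (n : nat) : Type := {ffun cell n -> R}.

Definition XT2 (R : realType) (n : nat) : Type := {ffun 'I_2 -> XT R n}.

(** The element of L^2(Omega) defined by v (the edges have measure zero). *)
Definition fun_of_XT (R : realType) (n : nat) (v : XT R n) : R * R -> R :=
  fun x => \sum_(K : cell n) v K * \1_(cell_set R K) x.

Definition leb2 (R : realType) :
    {measure set (measurableTypeR R * measurableTypeR R) -> \bar R} :=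
  (@lebesgue_measure R \x @lebesgue_measure R)%E.

(** Functions are extended by 0 outside Omega. *)
Definition in_L2 (R : realType) (f : R * R -> R) : Prop :=
  f \_ (Omega R) \in Lfun (leb2 R) 2%:E.

(** [fine] maps the norm, finite for f in L^2(Omega), to R. *)
Definition L2norm (R : realType) (f : R * R -> R) : R :=
  fine ('N[leb2 R]_2%:E[EFin \o (f \_ (Omega R))])%E.

Definition L2norm2 (R : realType) (f : 'I_2 -> R * R -> R) : R :=
  Num.sqrt (\sum_(d : 'I_2) L2norm (f d) ^+ 2).

Definition zero_mean (R : realType) (n : nat) (p : XT R n) : Prop :=
  \int[leb2 R]_(x in Omega R) fun_of_XT p x = 0.

Definition cell_mean (R : realType) (n : nat) (f : R * R -> R) (K : cell n) : R :=
  (step R n ^+ 2)^-1 * \int[leb2 R]_(x in cell_set R K) f x.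

(** In the first sum each internal edge is taken once,
    from its cell of smaller d-th coordinate. *)

Definition XT_normsq (R : realType) (n : nat) (v : XT R n) : R :=
  \sum_(K : cell n) \sum_(d : 'I_2) \sum_(L | across (d, true) K L)
     (v K - v L) ^+ 2
  + \sum_(K : cell n) \sum_(s : side | external s K) 2 * v K ^+ 2.

Definition XT2_norm (R : realType) (n : nat) (u : XT2 R n) : R :=
  Num.sqrt (\sum_(d : 'I_2) XT_normsq (u d)).

Definition neg_laplace (R : realType) (n : nat) (v : XT R n) (K : cell n) : R :=
  let h := step R n in
  (h ^+ 2)^-1 * (\sum_(s : side) \sum_(L | across s K L) (v K - v L))
  + 2 / h ^+ 2 * (\sum_(s : side | external s K) v K).

Definition grad (R : realType) (n : nat) (p : XT R n) (d : 'I_2) (K : cell n) : R :=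
  let h := step R n in
  (h ^+ 2)^-1 * (\sum_(s : side) \sum_(L | across s K L)
                    h * ((p K + p L) / 2) * normal R s d)
  + (h ^+ 2)^-1 * (\sum_(s : side | external s K) h * p K * normal R s d).

Definition div (R : realType) (n : nat) (u : XT2 R n) (K : cell n) : R :=
  let h := step R n in
  (h ^+ 2)^-1 * (\sum_(s : side) \sum_(L | across s K L)
                    h * (\sum_(d : 'I_2) (u d K + u d L) / 2 * normal R s d)).

Definition neg_laplace_cluster (R : realType) (n : nat) (p : XT R n)
    (K : cell n) : R :=
  (step R n ^+ 2)^-1 *
  (\sum_(s : side) \sum_(L | across s K L && same_cluster K L) (p K - p L)).

(** (u, p) belongs to X_T^2 x \bar X_T and solves the discrete problem. *)
Definition discrete_solution (R : realType) (lambda : R) (n : nat)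
    (f : 'I_2 -> R * R -> R) (u : XT2 R n) (p : XT R n) : Prop :=
  [/\ zero_mean p,
      forall (K : cell n) (d : 'I_2),
        neg_laplace (u d) K + grad p d K = cell_mean (f d) K
    & forall K : cell n,
        div u K + lambda * step R n ^+ 2 * neg_laplace_cluster p K = 0].

(* Main.v *)
Require Import Defs.
From HB Require Import structures.
From mathcomp Require Import all_boot all_order all_algebra.
From mathcomp Require Import all_classical all_reals all_analysis.
From mathcomp Require Import zify ring lra.
Set Implicit Arguments.
Unset Strict Implicit.
Unset Printing Implicit Defensive.
Import Order.TTheory GRing.Theory Num.Theory.
Import numFieldNormedType.Exports.
Local Open Scope classical_set_scope.
Local Open Scope ring_scope.

(** The centred divergence of this scheme satisfies no inf-sup condition uniformly in h;
    the penalty on the pressure jumps inside the clusters supplies what is missing.  With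
    P = h p and data h^2 f, lengths are measured in cells and the step disappears: all the
    estimates become inequalities, uniform in n, between sums over an integer grid.

    Testing the momentum balance with u and the mass balance with P bounds the discrete H1
    norm of u and the pressure jumps inside the clusters ([energy_bound]).  These jumps
    control P - Q, where Q is the mean of P over each cluster, so an inf-sup condition is
    needed only for pressures that are constant on clusters.  Take a staggered velocity on
    the mesh of the clusters, one normal component per edge.  It can be prolonged to the
    fine mesh so that the centred scheme sees exactly the staggered fluxes through the
    cluster sides ([divx_prolong]) and so that its norm is kept ([dirichlet_prolong]).
    Hence the staggered inf-sup condition on the coarse mesh, [coarse_inf_sup], bounds P
    ([pressure_bound]).

    The staggered condition follows from an argument of Friedrichs.  Let (U, V) vanish on the
    boundary and solve Lap (U, V) = grad Q; its energy is the pairing of Q with div (U, V).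
    Then f = Q - div (U, V), on the cells, and g = curl (U, V), on the nodes, satisfy the
    discrete Cauchy-Riemann equations, and g is bounded by the energy.  It remains to bound f
    by g ([friedrichs]).  With d the distance to the boundary, a Caccioppoli estimate gives
    sum d^2 |grad f|^2 <= C sum g^2 ([caccioppoli]), and f has zero mean, so that
    sum f^2 <= C sum d^2 |grad f|^2 ([improved_poincare]).  The last inequality combines a
    Hardy inequality along the diagonals issued from the four corners, on which d grows at
    unit rate, with the plain Poincare inequality in an inner box.

    The a priori estimate makes the finite-dimensional linear system injective, hence
    bijective once the redundant mass equation is traded for the mean of the pressure
    ([scheme_map]). *)

(** * One-dimensional difference operators *)

Section OneDim.
Variable R : realFieldType.
Implicit Types (a b c u p U W : nat -> R) (n m : nat).

Lemma sum_inner_right n (G : nat -> R) :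
  \sum_(i < n) (if (i.+1 < n)%N then G i else 0) = \sum_(i < n.-1) G i.
Proof.
case: n => [|k]; first by rewrite !big_ord0.
rewrite big_ord_recr /= ltnn addr0.
by apply: eq_bigr => i _; rewrite ltnS ltn_ord.
Qed.

Lemma sum_inner_left n (G : nat -> R) :
  \sum_(i < n) (if (0 < i)%N then G i else 0) = \sum_(i < n.-1) G i.+1.
Proof.
case: n => [|k]; first by rewrite !big_ord0.
by rewrite big_ord_recl /= add0r.
Qed.

Lemma sum_first n (G : nat -> R) : (0 < n)%N ->
  \sum_(i < n) (if (0 < i)%N then 0 else G i) = G 0%N.
Proof.
by case: n => // k _; rewrite big_ord_recl /= big1 ?addr0.
Qed.

Lemma sum_last n (G : nat -> R) : (0 < n)%N ->
  \sum_(i < n) (if (i.+1 < n)%N then 0 else G i) = G n.-1.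
Proof.
case: n => // k _; rewrite big_ord_recr /= ltnn big1 ?add0r // => i _.
by rewrite ltnS ltn_ord.
Qed.

Lemma sum_even_odd m (G : nat -> R) :
  \sum_(k < m.*2) G k = \sum_(i < m) (G i.*2 + G i.*2.+1).
Proof.
elim: m => [|m IH]; first by rewrite !big_ord0.
by rewrite doubleS !big_ord_recr /= IH addrA.
Qed.

Lemma sum_by_parts m c W : W 0%N = 0 -> W m = 0 ->
  \sum_(i < m) c i * (W i.+1 - W i) =
  \sum_(i < m.-1) (c i - c i.+1) * W i.+1.
Proof.
move=> W0; case: m => [|m] Wm; first by rewrite !big_ord0.
under eq_bigr do rewrite mulrBr.
rewrite sumrB big_ord_recr [X in _ - X]big_ord_recl /= Wm W0 !mulr0 addr0 add0r.
by rewrite -sumrB; apply: eq_bigr => i _; rewrite mulrBl.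
Qed.

(** The factor 2 at both ends is the homogeneous Dirichlet condition imposed at distance
    half a cell from the last cell centres. *)
Definition dirichlet1 n a b : R :=
  \sum_(i < n.-1) (a i.+1 - a i) * (b i.+1 - b i)
  + 2 * a 0%N * b 0%N + 2 * a n.-1 * b n.-1.

Definition lap1 n a (i : nat) : R :=
  (if (0 < i)%N then a i - a i.-1 else 2 * a i)
  + (if (i.+1 < n)%N then a i - a i.+1 else 2 * a i).

Definition grad1 n p (i : nat) : R :=
  (if (i.+1 < n)%N then (p i.+1 - p i) / 2 else 0)
  + (if (0 < i)%N then (p i - p i.-1) / 2 else 0).

Definition div1 n u (i : nat) : R :=
  (if (i.+1 < n)%N then (u i + u i.+1) / 2 else 0)
  - (if (0 < i)%N then (u i + u i.-1) / 2 else 0).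

(** The other index of the pair {2k, 2k+1}. *)
Definition mate (i : nat) : nat := if odd i then i.-1 else i.+1.

Lemma sum_lap1 n a b : (0 < n)%N ->
  \sum_(i < n) lap1 n a i * b i = dirichlet1 n a b.
Proof.
move=> n0; rewrite /dirichlet1 /lap1.
rewrite -(sum_first (fun i => 2 * a i * b i) n0).
rewrite -(sum_last (fun i => 2 * a i * b i) n0).
have -> : \sum_(i < n.-1) (a i.+1 - a i) * (b i.+1 - b i) =
  \sum_(i < n) (if (0 < i)%N then (a i - a i.-1) * b i else 0)
  + \sum_(i < n) (if (i.+1 < n)%N then (a i - a i.+1) * b i else 0).
  rewrite (sum_inner_left n (fun i => (a i - a i.-1) * b i)).
  rewrite (sum_inner_right n (fun i => (a i - a i.+1) * b i)) -big_split /=.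
  by apply: eq_bigr => i _; ring.
rewrite -!big_split /=; apply: eq_bigr => i _.
by case: ifP; case: ifP => _ _; ring.
Qed.

(** Extending p by its boundary value and u by its opposite makes the centred gradient
    and divergence adjoint up to sign. *)
Lemma sum_grad1 n p u : (0 < n)%N ->
  \sum_(i < n) grad1 n p i * u i = - \sum_(i < n) p i * div1 n u i.
Proof.
move=> n0; rewrite /grad1 /div1.
have -> : \sum_(i < n) ((if (i.+1 < n)%N then (p i.+1 - p i) / 2 else 0)
  + (if (0 < i)%N then (p i - p i.-1) / 2 else 0)) * u i =
  \sum_(i < n.-1) (p i.+1 - p i) * ((u i + u i.+1) / 2).
  under eq_bigr do rewrite mulrDl.
  rewrite big_split /=.
  under eq_bigr => i _ do rewrite (fun_if (fun x => x * u i)) mul0r.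
  rewrite (sum_inner_right n (fun i => (p i.+1 - p i) / 2 * u i)).
  under [X in _ + X]eq_bigr => i _ do rewrite (fun_if (fun x => x * u i)) mul0r.
  rewrite (sum_inner_left n (fun i => (p i - p i.-1) / 2 * u i)) -big_split /=.
  by apply: eq_bigr => i _; ring.
under [in RHS]eq_bigr do rewrite mulrBr.
rewrite sumrB.
under [in RHS]eq_bigr => i _ do rewrite (fun_if (fun x => p i * x)) mulr0.
rewrite (sum_inner_right n (fun i => p i * ((u i + u i.+1) / 2))).
under [X in _ - X]eq_bigr => i _ do rewrite (fun_if (fun x => p i * x)) mulr0.
rewrite (sum_inner_left n (fun i => p i * ((u i + u i.-1) / 2))) opprB -sumrB.
by apply: eq_bigr => i _ /=; ring.
Qed.

Lemma dirichlet1_ge0 n a : 0 <= dirichlet1 n a a.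
Proof.
have h : 0 <= \sum_(i < n.-1) (a i.+1 - a i) * (a i.+1 - a i).
  by apply: sumr_ge0 => i _; rewrite -expr2 sqr_ge0.
by rewrite /dirichlet1; nra.
Qed.

(** The centred divergence is the sum of a forward and a backward half difference. *)
Lemma sum_sqr_div1 n u : (0 < n)%N ->
  \sum_(i < n) div1 n u i ^+ 2 <= dirichlet1 n u u.
Proof.
move=> n0.
have -> : dirichlet1 n u u = \sum_(i < n)
    (2 * (if (i.+1 < n)%N then (u i.+1 - u i) / 2 else - u i) ^+ 2
   + 2 * (if (0 < i)%N then (u i - u i.-1) / 2 else u i) ^+ 2).
  rewrite /dirichlet1 -(sum_first (fun i => 2 * u i * u i) n0).
  rewrite -(sum_last (fun i => 2 * u i * u i) n0).
  have -> : \sum_(i < n.-1) (u i.+1 - u i) * (u i.+1 - u i) =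
    \sum_(i < n) (if (0 < i)%N then 2 * ((u i - u i.-1) / 2) ^+ 2 else 0)
    + \sum_(i < n) (if (i.+1 < n)%N then 2 * ((u i.+1 - u i) / 2) ^+ 2 else 0).
    rewrite (sum_inner_left n (fun i => 2 * ((u i - u i.-1) / 2) ^+ 2)).
    rewrite (sum_inner_right n (fun i => 2 * ((u i.+1 - u i) / 2) ^+ 2)).
    by rewrite -big_split /=; apply: eq_bigr => i _; field.
  rewrite -!big_split /=; apply: eq_bigr => i _.
  by case: ifP; case: ifP => _ _; ring.
have young (x y : R) : (x + y) ^+ 2 <= 2 * x ^+ 2 + 2 * y ^+ 2.
  by have := sqr_ge0 (x - y); nra.
apply: ler_sum => i _; apply: le_trans (young _ _).
by rewrite le_eqVlt; apply/orP; left; apply/eqP; rewrite /div1;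
   case: ifP => _; case: ifP => _; field.
Qed.

(** Cauchy-Schwarz for a sum of t + 1 increments, split as t plus one. *)
Lemma young_step (t D x y : R) : 0 <= t -> 0 <= D -> x ^+ 2 <= t * D ->
  (x + y) ^+ 2 <= (t + 1) * (D + y ^+ 2).
Proof.
move=> t0 D0 h; have [t_eq0|t_neq0] := eqVneq t 0.
  have : x ^+ 2 <= 0 by rewrite t_eq0 mul0r in h.
  rewrite exprn_even_le0 //= t_eq0 => /eqP ->; rewrite !add0r mul1r lerDr //.
have t_gt0 : 0 < t by rewrite lt_def t_neq0.
have h3 : 0 <= t * (x / t - y) ^+ 2 by rewrite mulr_ge0 // sqr_ge0.
have h2 : t * (x / t - y) ^+ 2 = x ^+ 2 / t - 2 * x * y + t * y ^+ 2 by field.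
have h4 : x ^+ 2 / t <= D by rewrite ler_pdivrMr // mulrC.
nra.
Qed.

Lemma sqr_increment a s :
  (a s - a 0%N) ^+ 2 <= s%:R * \sum_(l < s) (a l.+1 - a l) ^+ 2.
Proof.
elim: s => [|s IH]; first by rewrite subrr expr0n big_ord0 mulr0.
rewrite big_ord_recr /= -natr1.
have -> : a s.+1 - a 0%N = (a s - a 0%N) + (a s.+1 - a s) by ring.
by apply: young_step; rewrite ?ler0n // sumr_ge0 // => l _; rewrite sqr_ge0.
Qed.

Lemma sqr_oscillation a n i k : (i < n)%N -> (k < n)%N ->
  (a i - a k) ^+ 2 <= n%:R * \sum_(l < n.-1) (a l.+1 - a l) ^+ 2.
Proof.
wlog ki : i k / (k <= i)%N.
  move=> W iN kN; case: (leqP k i) => [ki|/ltnW ik]; first exact: W.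
  by rewrite -opprB sqrrN; apply: W.
move=> iN kN.
have := sqr_increment (fun l => a (k + l)%N) (i - k).
rewrite addn0 subnKC // => /le_trans; apply.
rewrite ler_pM ?ler0n ?sumr_ge0 // => [l _||]; first exact: sqr_ge0.
  by rewrite ler_nat; lia.
have -> : n.-1 = (k + (i - k) + (n.-1 - i))%N by lia.
rewrite !big_split_ord /=.
under [X in X <= _]eq_bigr do rewrite addnS.
rewrite -addrA addrC -addrA lerDl addr_ge0 // sumr_ge0 // => l _; exact: sqr_ge0.
Qed.

Lemma poincare1 n a : (0 < n)%N ->
  \sum_(i < n) a i ^+ 2 <= n%:R ^+ 2 * dirichlet1 n a a.
Proof.
move=> n0; set D := dirichlet1 n a a.
have H i : (i < n)%N -> a i ^+ 2 <= n%:R * D.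
  move=> iN; pose b l := if l is l'.+1 then a l' else 0.
  have := sqr_increment b i.+1; rewrite /b subr0 => /le_trans; apply.
  rewrite ler_pM ?ler0n ?sumr_ge0 // => [l _||]; rewrite ?sqr_ge0 ?ler_nat //.
  rewrite big_ord_recl /= subr0 /D /dirichlet1.
  have h1 : \sum_(l < i) (a l.+1 - a l) ^+ 2 <=
     \sum_(l < n.-1) (a l.+1 - a l) * (a l.+1 - a l).
    have -> : n.-1 = (i + (n.-1 - i))%N by lia.
    rewrite big_split_ord /= lerDl sumr_ge0 // => l _.
    by rewrite -expr2 sqr_ge0.
  by nra.
have -> : n%:R ^+ 2 * D = \sum_(i < n) n%:R * D.
  by rewrite sumr_const card_ord -[RHS]mulr_natl expr2 mulrA.
by apply: ler_sum => i _; apply: H.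
Qed.

End OneDim.

(** * Weighted Poincare inequality on a square grid *)

Section Grid.
Variable R : realFieldType.
Implicit Types (f g : nat -> nat -> R) (m N : nat).

Definition gsum m f : R := \sum_(i < m) \sum_(j < m) f i j.

Definition transpose f i j := f j i.

Lemma gsum_transpose m f : gsum m (transpose f) = gsum m f.
Proof. by rewrite /gsum exchange_big. Qed.

Lemma eq_gsum m f g :
  (forall i j, (i < m)%N -> (j < m)%N -> f i j = g i j) -> gsum m f = gsum m g.
Proof. by move=> e; apply: eq_bigr => i _; apply: eq_bigr => j _; apply: e. Qed.

Lemma le_gsum m f g :
  (forall i j, (i < m)%N -> (j < m)%N -> f i j <= g i j) -> gsum m f <= gsum m g.
Proof. by move=> e; apply: ler_sum => i _; apply: ler_sum => j _; apply: e. Qed.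

Lemma gsum_ge0 m f :
  (forall i j, (i < m)%N -> (j < m)%N -> 0 <= f i j) -> 0 <= gsum m f.
Proof. by move=> e; apply: sumr_ge0 => i _; apply: sumr_ge0 => j _; apply: e. Qed.

Lemma gsumD m f g : gsum m (fun i j => f i j + g i j) = gsum m f + gsum m g.
Proof. by rewrite /gsum -big_split; apply: eq_bigr => i _; rewrite -big_split. Qed.

Lemma gsumZ m (k : R) f : gsum m (fun i j => k * f i j) = k * gsum m f.
Proof.
by rewrite /gsum mulr_sumr; apply: eq_bigr => i _; rewrite mulr_sumr.
Qed.

Lemma gsum_const m (k : R) : gsum m (fun _ _ => k) = m%:R ^+ 2 * k.
Proof.
by rewrite /gsum !sumr_const !card_ord -mulrnA -[LHS]mulr_natl natrM expr2.
Qed.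

Lemma gsum_rev m f : gsum m (fun i j => f (m.-1 - i)%N j) = gsum m f.
Proof.
rewrite /gsum [RHS](reindex_inj rev_ord_inj) /=.
apply: eq_bigr => i _; apply: eq_bigr => j _.
by congr (f _ j); have := ltn_ord i; lia.
Qed.

Lemma sum_widen n k (F : nat -> R) : (n <= k)%N ->
  (forall i, (i < k)%N -> 0 <= F i) -> \sum_(i < n) F i <= \sum_(i < k) F i.
Proof.
move=> /subnKC <- F0; rewrite big_split_ord /= lerDl sumr_ge0 // => i _.
by apply: F0; have := ltn_ord i; lia.
Qed.

Lemma sum_support T n k (F : nat -> R) : (T + n <= k)%N ->
  (forall i, ~~ (T <= i < T + n)%N -> F i = 0) ->
  \sum_(i < k) F i = \sum_(i < n) F (T + i)%N.
Proof.
move=> /subnKC <- F0; rewrite !big_split_ord /= big1 => [|i _]; last first.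
  by apply: F0; have := ltn_ord i; lia.
rewrite add0r [X in _ + X]big1 ?addr0 // => i _.
by apply: F0; lia.
Qed.

Lemma sum_window T n k (F : nat -> R) : (T + n <= k)%N ->
  (forall i, (i < k)%N -> 0 <= F i) ->
  \sum_(i < n) F (T + i)%N <= \sum_(i < k) F i.
Proof.
move=> Tnk F0; apply: le_trans (sum_widen Tnk F0).
rewrite big_split_ord /= lerDr sumr_ge0 // => i _.
by apply: F0; have := ltn_ord i; lia.
Qed.

Lemma sum_shift_le n (F : nat -> R) :
  (forall i, (i < n)%N -> 0 <= F i) -> \sum_(i < n.-1) F i.+1 <= \sum_(i < n) F i.
Proof.
case: n => [|n] F0; first by rewrite !big_ord0.
by rewrite big_ord_recl lerDr F0.
Qed.

(** The constant is the first value on the row of least oscillation: any value is reached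
    from it through that row and one column, and the chosen row costs at most the average
    over the rows. *)
Lemma poincare_box N g : exists c : R,
  gsum N (fun i j => (g i j - c) ^+ 2) <=
  2 * N%:R ^+ 2 * (\sum_(i < N.-1) \sum_(j < N) (g i.+1 j - g i j) ^+ 2
             + \sum_(i < N) \sum_(j < N.-1) (g i j.+1 - g i j) ^+ 2).
Proof.
case: N => [|n]; first by exists 0; rewrite /gsum !big_ord0 expr0n mulr0 mul0r.
set N := n.+1.
rewrite exchange_big /=.
pose X j := \sum_(i < N.-1) (g i.+1 j - g i j) ^+ 2.
pose Y i := \sum_(j < N.-1) (g i j.+1 - g i j) ^+ 2.
rewrite -/(\sum_(j < N) X j) -/(\sum_(i < N) Y i).
case: (@arg_minP _ _ 'I_N ord0 xpredT (fun i => Y i) isT) => k _ kmin.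
have Yk : N%:R * Y k <= \sum_(i < N) Y i.
  have -> : N%:R * Y k = \sum_(i < N) Y k.
    by rewrite sumr_const card_ord mulr_natl.
  by apply: ler_sum => i _; apply: kmin.
exists (g k 0%N).
have osc i j : (i < N)%N -> (j < N)%N ->
    (g i j - g k 0%N) ^+ 2 <= 2 * N%:R * (X j + Y k).
  move=> iN jN.
  have h1 := sqr_oscillation (fun l => g l j) iN (ltn_ord k).
  have h2 := sqr_oscillation (fun l => g k l) jN (isT : (0 < N)%N).
  rewrite -/(X j) in h1; rewrite -/(Y k) in h2.
  have := sqr_ge0 ((g i j - g k j) - (g k j - g k 0%N)); nra.
apply: (le_trans (le_gsum osc)); rewrite gsumZ gsumD gsum_const.
have -> : gsum N (fun _ j => X j) = N%:R * \sum_(j < N) X j.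
  by rewrite /gsum sumr_const card_ord mulr_natl.
have N0 : 0 <= N%:R :> R by rewrite ler0n.
set x := \sum_(j < N) X j; set y := \sum_(i < N) Y i in Yk *.
have -> : 2 * N%:R * (N%:R * x + N%:R ^+ 2 * Y k)
  = 2 * N%:R ^+ 2 * (x + N%:R * Y k) by ring.
by rewrite ler_wpM2l ?lerD2l // mulr_ge0 ?ler0n ?sqr_ge0.
Qed.

(** Distance to the boundary, in cells, of the edge between the cells (i, j) and
    (i + 1, j); the edge between (j, i) and (j, i + 1) has the same distance. *)
Definition edist m i j : nat := minn (minn i.+1 (m.-1 - i)) (minn j.+1 (m - j)).

Definition xenergy m f : R :=
  \sum_(i < m.-1) \sum_(j < m) (edist m i j)%:R ^+ 2 * (f i.+1 j - f i j) ^+ 2.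

Definition energy m f := xenergy m f + xenergy m (transpose f).

Definition flip m f i j : R := f (m.-1 - i)%N j.

Lemma xenergy_flip m f : xenergy m (flip m f) = xenergy m f.
Proof.
rewrite /xenergy [RHS](reindex_inj rev_ord_inj) /=.
apply: eq_bigr => i _; apply: eq_bigr => j _; have iP := ltn_ord i.
congr (_%:R ^+ 2 * _); first by rewrite /edist; lia.
rewrite /flip -[RHS]sqrrN opprB.
by congr ((f _ j - f _ j) ^+ 2); lia.
Qed.

Lemma xenergy_transpose_flip m f :
  xenergy m (transpose (flip m f)) = xenergy m (transpose f).
Proof.
rewrite /xenergy; apply: eq_bigr => i _.
rewrite [RHS](reindex_inj rev_ord_inj) /=; apply: eq_bigr => j _.
have jP := ltn_ord j; have iP := ltn_ord i.
congr (_%:R ^+ 2 * _); first by rewrite /edist; lia.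
rewrite /flip /transpose.
by congr ((f _ _ - f _ _) ^+ 2); lia.
Qed.

Lemma energy_flip m f : energy m (flip m f) = energy m f.
Proof. by rewrite /energy xenergy_flip xenergy_transpose_flip. Qed.

Lemma energy_transpose m f : energy m (transpose f) = energy m f.
Proof. by rewrite /energy addrC. Qed.

Lemma gsum_flip m f : gsum m (flip m f) = gsum m f.
Proof. exact: gsum_rev. Qed.

Definition hardy_width m : nat := (m %/ 8)%N.
Definition diag_band m (i j : nat) : bool :=
  (i < m.+1 %/ 2 + j)%N && (j < m.+1 %/ 2 + i)%N.
Definition corner m i j := diag_band m i j && (minn i j < hardy_width m)%N.
Definition inner m (i j : nat) := let T := hardy_width m in
  [&& T <= i, T <= j, i < m - T & j < m - T]%N.
(** Depth measured along a diagonal: it grows with slope one up to the Hardy width, then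
    goes back to zero with slope minus one, and depends only on the position on the
    diagonal.  The band keeps the diagonals away from the two opposite sides. *)
Definition tent m (i j : nat) : R :=
  if diag_band m i j then
    (minn (minn i j) ((hardy_width m).*2 - minn i j))%:R else 0.

Lemma gsum_widen m f :
  (forall i j, (i < m)%N -> (j < m)%N -> 0 <= f i j) -> gsum m.-1 f <= gsum m f.
Proof.
move=> f0; apply: (@le_trans _ _ (\sum_(i < m.-1) \sum_(j < m) f i j)).
  apply: ler_sum => i _; apply: sum_widen; first exact: leq_pred.
  by move=> j jm; apply: f0 => //; have := ltn_ord i; lia.
apply: (@sum_widen _ m (fun i => \sum_(j < m) f i j)); first exact: leq_pred.
by move=> i im; apply: sumr_ge0 => j _; apply: f0.
Qed.

Lemma gsum_shift_le m f :
  (forall i j, (i < m)%N -> (j < m)%N -> 0 <= f i j) ->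
  gsum m.-1 (fun i j => f i.+1 j.+1) <= gsum m f.
Proof.
move=> f0; apply: (@le_trans _ _ (\sum_(i < m.-1) \sum_(j < m) f i.+1 j)).
  apply: ler_sum => i _; apply: (@sum_shift_le m (fun j => f i.+1 j)) => j jm.
  by apply: f0 => //; have := ltn_ord i; lia.
apply: (@sum_shift_le m (fun i => \sum_(j < m) f i j)) => i im.
by apply: sumr_ge0 => j _; apply: f0.
Qed.

Lemma gsum_pred m f :
  (forall i j, (i < m)%N -> (j < m)%N -> (i == m.-1) || (j == m.-1) -> f i j = 0) ->
  gsum m f = gsum m.-1 f.
Proof.
case: m => [|m] f0; rewrite /gsum // big_ord_recr /= in f0 *.
rewrite [X in _ + X]big1 ?addr0 => [|j _]; last by rewrite f0 ?eqxx.
apply: eq_bigr => i _; rewrite big_ord_recr /= f0 ?eqxx ?orbT ?addr0 //.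
by rewrite ltnS ltnW.
Qed.

(** Telescoping along the diagonals. *)
Lemma gsum_diag m f :
  (forall i j, (i < m)%N -> (j < m)%N ->
     [|| i == 0, j == 0, i == m.-1 | j == m.-1] -> f i j = 0) ->
  gsum m.-1 (fun i j => f i.+1 j.+1) = gsum m.-1 f.
Proof.
move=> f0; rewrite -(gsum_pred (f := f)) => [|i j im jm h]; last first.
  by apply: f0 => //; case/orP: h => ->; rewrite !orbT.
case: m f0 => [|m] f0; first by rewrite /gsum !big_ord0.
rewrite /gsum [RHS]big_ord_recl /=.
rewrite [X in _ = X + _]big1 ?add0r => [|j _]; last by rewrite f0.
by apply: eq_bigr => i _; rewrite [RHS]big_ord_recl f0 ?add0r // ltnS ltn_ord.
Qed.

(** One-dimensional Hardy inequality on each diagonal issued from the corner, proved by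
    summing the increments of the tent profile against f^2.  Where the tent increases the
    sum of f^2 is recovered, where it decreases the cells lie in the inner box, and the
    weight of the tent never exceeds the distance to the boundary. *)
Lemma hardy_corner m f :
  gsum m (fun i j => (corner m i j)%:R * f i j ^+ 2) <=
  gsum m (fun i j => (inner m i j)%:R * f i j ^+ 2) + 32 * energy m f
  + (16%:R)^-1 * gsum m (fun i j => f i j ^+ 2).
Proof.
set S := gsum m (fun i j => f i j ^+ 2).
pose T := hardy_width m.
pose mid i j := diag_band m i j && (T <= minn i j < T.*2)%N.
have tentS i j : tent m i.+1 j.+1 - tent m i j = (corner m i j)%:R - (mid i j)%:R.
  rewrite /tent /corner /mid -/T.
  have -> : diag_band m i.+1 j.+1 = diag_band m i j by rewrite /diag_band; lia.
  case: (diag_band m i j); last by rewrite subrr.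
  have -> : minn i.+1 j.+1 = (minn i j).+1 by lia.
  set k := minn i j; rewrite !andTb.
  have [kT|kT] := ltnP k T; have [kT2|kT2] := ltnP k T.*2; rewrite ?andbF ?andbT /=; try lia.
  - have -> : minn k.+1 (T.*2 - k.+1) = (minn k (T.*2 - k)).+1 by lia.
    by rewrite -natr1; ring.
  - have -> : minn k (T.*2 - k) = (minn k.+1 (T.*2 - k.+1)).+1 by lia.
    by rewrite -natr1; ring.
  - have -> : minn k.+1 (T.*2 - k.+1) = 0%N by lia.
    by have -> : minn k (T.*2 - k) = 0%N by lia.
have shift : gsum m.-1 (fun i j => tent m i.+1 j.+1 * f i.+1 j.+1 ^+ 2) =
    gsum m.-1 (fun i j => tent m i j * f i j ^+ 2).
  apply: (gsum_diag (f := fun i j => tent m i j * f i j ^+ 2)) => i j im jm h.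
  rewrite /tent; case: ifP => [b|_]; last by rewrite mul0r.
  have -> : minn (minn i j) ((hardy_width m).*2 - minn i j) = 0%N.
    by move: b h; rewrite /diag_band /hardy_width; lia.
  by rewrite mul0r.
have tent_x i j : (i < m.-1)%N -> (j < m.-1)%N ->
    0 <= tent m i.+1 j.+1 <= (edist m i j.+1)%:R.
  move=> im jm; rewrite /tent; case: ifP => [b|_]; last by rewrite lexx ler0n.
  by rewrite ler0n ler_nat; move: b; rewrite /diag_band /edist /hardy_width; lia.
have tent_y i j : (i < m.-1)%N -> (j < m.-1)%N ->
    tent m i.+1 j.+1 <= (edist m j i)%:R.
  move=> im jm; rewrite /tent; case: ifP => [b|_]; last by rewrite ler0n.
  by rewrite ler_nat; move: b; rewrite /diag_band /edist /hardy_width; lia.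
have young (t a b x y z : R) : 0 <= t -> t <= a -> t <= b ->
    t * (x ^+ 2 - y ^+ 2) <=
    32 * (a ^+ 2 * (y - z) ^+ 2 + b ^+ 2 * (z - x) ^+ 2) + 32^-1 * (x ^+ 2 + y ^+ 2).
  move=> t0 ta tb.
  have h1 : 0 <= (4 * t * (x - y) - 8^-1 * (x + y)) ^+ 2 by exact: sqr_ge0.
  have h2 : 0 <= (x - y) ^+ 2 by exact: sqr_ge0.
  have h3 : t ^+ 2 * (y - z) ^+ 2 <= a ^+ 2 * (y - z) ^+ 2.
    by rewrite ler_wpM2r ?sqr_ge0 // lerXn2r // nnegrE // (le_trans t0).
  have h4 : t ^+ 2 * (z - x) ^+ 2 <= b ^+ 2 * (z - x) ^+ 2.
    by rewrite ler_wpM2r ?sqr_ge0 // lerXn2r // nnegrE // (le_trans t0).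
  have h5 : 0 <= t ^+ 2 * (2 * z - x - y) ^+ 2 by rewrite mulr_ge0 ?sqr_ge0.
  by lra.
have point i j : (i < m.-1)%N -> (j < m.-1)%N ->
  (corner m i j)%:R * f i j ^+ 2 + tent m i j * f i j ^+ 2 <=
  (mid i j)%:R * f i j ^+ 2 + tent m i.+1 j.+1 * f i.+1 j.+1 ^+ 2
  + 32 * ((edist m i j.+1)%:R ^+ 2 * (f i.+1 j.+1 - f i j.+1) ^+ 2
        + (edist m j i)%:R ^+ 2 * (f i j.+1 - f i j) ^+ 2)
  + 32^-1 * (f i j ^+ 2 + f i.+1 j.+1 ^+ 2).
  move=> im jm; have /andP[t0 ta] := tent_x i j im jm.
  have := young _ _ _ (f i j) (f i.+1 j.+1) (f i j.+1) t0 ta (tent_y i j im jm).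
  rewrite mulrBr => h.
  have -> : (corner m i j)%:R * f i j ^+ 2 + tent m i j * f i j ^+ 2 =
     (mid i j)%:R * f i j ^+ 2 + tent m i.+1 j.+1 * f i j ^+ 2.
    by rewrite -!mulrDl; congr (_ * _); have := tentS i j; lra.
  lra.
have := le_gsum point; rewrite !gsumD !gsumZ !gsumD shift.
have corner_box : gsum m (fun i j => (corner m i j)%:R * f i j ^+ 2) =
    gsum m.-1 (fun i j => (corner m i j)%:R * f i j ^+ 2).
  apply: gsum_pred => i j im jm h; have -> : corner m i j = false.
    by move: h; rewrite /corner /diag_band /hardy_width; lia.
  by rewrite mul0r.
have mid_inner : gsum m.-1 (fun i j => (mid i j)%:R * f i j ^+ 2) <=
    gsum m (fun i j => (inner m i j)%:R * f i j ^+ 2).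
  apply: le_trans (gsum_widen _); last by move=> *; rewrite mulr_ge0 ?sqr_ge0.
  apply: le_gsum => i j im jm; rewrite ler_wpM2r ?sqr_ge0 // ler_nat.
  by rewrite /mid /diag_band /inner /T /hardy_width; lia.
have ex : gsum m.-1 (fun i j => (edist m i j.+1)%:R ^+ 2 * (f i.+1 j.+1 - f i j.+1) ^+ 2)
  <= xenergy m f.
  apply: ler_sum => i _.
  apply: (@sum_shift_le m (fun j => (edist m i j)%:R ^+ 2 * (f i.+1 j - f i j) ^+ 2)).
  by move=> j _; rewrite mulr_ge0 ?sqr_ge0.
have ey : gsum m.-1 (fun i j => (edist m j i)%:R ^+ 2 * (f i j.+1 - f i j) ^+ 2)
  <= xenergy m (transpose f).
  rewrite /gsum exchange_big /=; apply: ler_sum => j _.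
  apply: (@sum_widen _ m (fun i => (edist m j i)%:R ^+ 2 * (f i j.+1 - f i j) ^+ 2)).
    by lia.
  by move=> i _; rewrite mulr_ge0 ?sqr_ge0.
have s1 : gsum m.-1 (fun i j => f i j ^+ 2) <= S.
  by apply: gsum_widen => *; rewrite sqr_ge0.
have s2 : gsum m.-1 (fun i j => f i.+1 j.+1 ^+ 2) <= S.
  by apply: (@gsum_shift_le m (fun i j => f i j ^+ 2)) => *; rewrite sqr_ge0.
rewrite corner_box /energy; set e1 := gsum _ _ in ex *; set e2 := gsum _ _ in ey *.
lra.
Qed.

Lemma inner_flip m i j : (i < m)%N -> inner m (m.-1 - i) j = inner m i j.
Proof. by rewrite /inner /hardy_width; lia. Qed.

Lemma inner_transpose m i j : inner m j i = inner m i j.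
Proof. by rewrite /inner; lia. Qed.

Definition inner_sum m f := gsum m (fun i j => (inner m i j)%:R * f i j ^+ 2).

Lemma inner_sum_flip m f : inner_sum m (flip m f) = inner_sum m f.
Proof.
rewrite /inner_sum -(gsum_flip m (fun i j => _ * f i j ^+ 2)).
by apply: eq_gsum => i j im jm; rewrite /flip inner_flip.
Qed.

Lemma inner_sum_transpose m f : inner_sum m (transpose f) = inner_sum m f.
Proof.
rewrite /inner_sum -(gsum_transpose m (fun i j => _ * f i j ^+ 2)).
by apply: eq_gsum => i j im jm; rewrite /transpose inner_transpose.
Qed.

(** In the inner box all distances to the boundary are comparable to the size of the
    box, so that the weight absorbs the constant of the plain inequality. *)
Lemma inner_poincare m f : exists c : R,
  inner_sum m (fun i j => f i j - c) <= 128 * energy m f.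
Proof.
pose T := hardy_width m; pose N := (m - T.*2)%N.
have [c hc] := poincare_box N (fun i j => f (T + i)%N (T + j)%N).
have Nm : (T + N + T)%N = m by rewrite /N /T /hardy_width; lia.
have TN : (T + N <= m)%N by lia.
have restrict (F : nat -> R) : (forall i, ~~ (T <= i < m - T)%N -> F i = 0) ->
    \sum_(i < m) F i = \sum_(i < N) F (T + i)%N.
  move=> F0; apply: sum_support TN _ => i out.
  by apply: F0; lia.
exists c.
have -> : inner_sum m (fun i j => f i j - c) =
    gsum N (fun i j => (f (T + i)%N (T + j)%N - c) ^+ 2).
  rewrite /inner_sum /gsum.
  rewrite (restrict (fun i => \sum_(j < m) (inner m i j)%:R * (f i j - c) ^+ 2)).
    apply: eq_bigr => i _.
    rewrite (restrict (fun j => (inner m (T + i) j)%:R * (f (T + i)%N j - c) ^+ 2)).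
      apply: eq_bigr => j _; have iN := ltn_ord i; have jN := ltn_ord j.
      by rewrite (_ : inner m _ _ = true) ?mul1r // /inner -/T; lia.
    by move=> j out; rewrite (_ : inner m _ _ = false) ?mul0r // /inner -/T; lia.
  move=> i out; apply: big1 => j _.
  by rewrite (_ : inner m _ _ = false) ?mul0r // /inner -/T; lia.
apply: (le_trans hc).
have weight i j (x : R) : (i < N.-1)%N -> (j < N)%N ->
    N%:R ^+ 2 * x ^+ 2 <= 64 * ((edist m (T + i) (T + j))%:R ^+ 2 * x ^+ 2).
  move=> iN jN; rewrite mulrA ler_wpM2r ?sqr_ge0 //.
  have : N%:R <= 8 * (edist m (T + i) (T + j))%:R :> R.
    by rewrite -natrM ler_nat /edist; move: Nm; rewrite /T /hardy_width; lia.
  have : 0 <= N%:R :> R by rewrite ler0n.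
  by nra.
have ener g : N%:R ^+ 2 * (\sum_(i < N.-1) \sum_(j < N)
      (g (T + i.+1)%N (T + j)%N - g (T + i)%N (T + j)%N) ^+ 2) <= 64 * xenergy m g.
  under eq_bigr do under eq_bigr do rewrite addnS.
  rewrite mulr_sumr; under eq_bigr do rewrite mulr_sumr.
  apply: (@le_trans _ _ (\sum_(i < N.-1) \sum_(j < N)
     64 * ((edist m (T + i) (T + j))%:R ^+ 2 *
           (g (T + i).+1 (T + j)%N - g (T + i)%N (T + j)%N) ^+ 2))).
    by apply: ler_sum => i _; apply: ler_sum => j _; apply: weight.
  under eq_bigr do rewrite -mulr_sumr.
  rewrite -mulr_sumr ler_wpM2l //.
  apply: (@le_trans _ _ (\sum_(i < N.-1) \sum_(j < m)
     (edist m (T + i) j)%:R ^+ 2 * (g (T + i).+1 j - g (T + i)%N j) ^+ 2)).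
    apply: ler_sum => i _.
    apply: (@sum_window T N m (fun j =>
      (edist m (T + i) j)%:R ^+ 2 * (g (T + i).+1 j - g (T + i)%N j) ^+ 2)).
      exact: TN.
    by move=> *; rewrite mulr_ge0 ?sqr_ge0.
  apply: (@sum_window T N.-1 m.-1 (fun i => \sum_(j < m)
     (edist m i j)%:R ^+ 2 * (g i.+1 j - g i j) ^+ 2)); first by lia.
  by move=> i _; apply: sumr_ge0 => j _; rewrite mulr_ge0 ?sqr_ge0.
rewrite [X in _ * (_ + X)]exchange_big /=.
have := ener f; have := ener (transpose f).
by rewrite /energy /transpose; lra.
Qed.

(** The reflections of the square carry the corner estimate to its four corners, which
    together with the inner box cover the grid.  The resulting terms in f^2 have total
    weight one quarter and are absorbed. *)
Lemma improved_poincare m f : gsum m f = 0 ->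
  gsum m (fun i j => f i j ^+ 2) <= 1024 * energy m f.
Proof.
move=> f0; have [c hc] := inner_poincare m f.
pose e i j := f i j - c; rewrite -/e in hc.
have eE : energy m e = energy m f.
  by congr (_ + _); apply: eq_bigr => i _; apply: eq_bigr => j _;
     rewrite /e /transpose; congr (_ * _ ^+ 2); ring.
have fe : gsum m (fun i j => f i j ^+ 2) <= gsum m (fun i j => e i j ^+ 2).
  have -> : gsum m (fun i j => e i j ^+ 2) =
      gsum m (fun i j => f i j ^+ 2) + ((- 2 * c) * gsum m f + gsum m (fun _ _ => c ^+ 2)).
    by rewrite -gsumZ -!gsumD; apply: eq_gsum => i j _ _; rewrite /e; ring.
  rewrite f0 mulr0 add0r lerDl; apply: gsum_ge0 => *; exact: sqr_ge0.
apply: (le_trans fe).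
have cover i j : (i < m)%N -> (j < m)%N -> e i j ^+ 2 <=
    (inner m i j)%:R * e i j ^+ 2 + (corner m i j)%:R * e i j ^+ 2
    + (corner m (m.-1 - i) j)%:R * e i j ^+ 2
    + (corner m i (m.-1 - j))%:R * e i j ^+ 2
    + (corner m (m.-1 - i) (m.-1 - j))%:R * e i j ^+ 2.
  move=> im jm; rewrite -!mulrDl -!natrD ler_peMl ?sqr_ge0 // ler1n.
  have Tm : (hardy_width m * 8 <= m)%N by rewrite /hardy_width leq_divM.
  have [//|out] := boolP (inner m i j).
  have [i2|i2] := ltnP i.*2 m; have [j2|j2] := ltnP j.*2 m.
  - have -> : corner m i j by move: out; rewrite /corner /diag_band /inner; lia.
    by [].
  - have -> : corner m i (m.-1 - j).
      by move: out; rewrite /corner /diag_band /inner; lia.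
    by rewrite addnAC addn1.
  - have -> : corner m (m.-1 - i) j.
      by move: out; rewrite /corner /diag_band /inner; lia.
    by rewrite -addnA addnAC addn1.
  - have -> : corner m (m.-1 - i) (m.-1 - j).
      by move: out; rewrite /corner /diag_band /inner; lia.
    by rewrite addn1.
have := le_gsum cover; rewrite !gsumD -/(inner_sum m e).
set S := gsum m (fun i j => e i j ^+ 2).
have H g : energy m g = energy m e -> inner_sum m g = inner_sum m e ->
    gsum m (fun i j => g i j ^+ 2) = S ->
    gsum m (fun i j => (corner m i j)%:R * g i j ^+ 2) <=
    inner_sum m e + 32 * energy m e + 16^-1 * S.
  by move=> <- <- <-; apply: hardy_corner.
have Sflip g : gsum m (fun i j => flip m g i j ^+ 2) = gsum m (fun i j => g i j ^+ 2).
  exact: (gsum_flip m (fun i j => g i j ^+ 2)).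
have Str g : gsum m (fun i j => transpose g i j ^+ 2) = gsum m (fun i j => g i j ^+ 2).
  exact: (gsum_transpose m (fun i j => g i j ^+ 2)).
have h1 := H e erefl erefl erefl.
have h2 := H (flip m e) (energy_flip _ _) (inner_sum_flip _ _) (Sflip _).
pose y := transpose (flip m (transpose e)).
have ey : energy m y = energy m e.
  by rewrite energy_transpose energy_flip energy_transpose.
have iy : inner_sum m y = inner_sum m e.
  by rewrite inner_sum_transpose inner_sum_flip inner_sum_transpose.
have Sy : gsum m (fun i j => y i j ^+ 2) = S by rewrite Str Sflip Str.
have h3 := H y ey iy Sy.
have h4 := H (flip m y) (etrans (energy_flip _ _) ey)
  (etrans (inner_sum_flip _ _) iy) (etrans (Sflip _) Sy).
have c2 : gsum m (fun i j => (corner m (m.-1 - i) j)%:R * e i j ^+ 2) =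
    gsum m (fun i j => (corner m i j)%:R * flip m e i j ^+ 2).
  rewrite -gsum_flip; apply: eq_gsum => i j im jm.
  by rewrite /flip subKn //; lia.
have c3 : gsum m (fun i j => (corner m i (m.-1 - j))%:R * e i j ^+ 2) =
    gsum m (fun i j => (corner m i j)%:R * y i j ^+ 2).
  rewrite -gsum_transpose -gsum_flip -[RHS]gsum_transpose.
  apply: eq_gsum => i j im jm.
  by rewrite /y /flip /transpose subKn //; lia.
have c4 : gsum m (fun i j => (corner m (m.-1 - i) (m.-1 - j))%:R * e i j ^+ 2) =
    gsum m (fun i j => (corner m i j)%:R * flip m y i j ^+ 2).
  rewrite -gsum_flip -gsum_transpose -gsum_flip -[RHS]gsum_transpose.
  apply: eq_gsum => i j im jm.
  by rewrite /y /flip /transpose !subKn //; lia.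
rewrite c2 c3 c4 -eE => hS; rewrite -eE in hc.
by lra.
Qed.

End Grid.

(** * Discrete Friedrichs inequality *)

Section Friedrichs.
Variable R : realFieldType.
Implicit Types (f g : nat -> nat -> R) (m : nat).

Definition ndist m i j : nat := minn (minn i (m - i)) (minn j (m - j)).

(** Every inner edge contributes its two end nodes; the corners of the square, where a curl
    has no meaning, never occur. *)
Definition edge_nodes m g : R :=
  \sum_(i < m.-1) \sum_(j < m) (g i.+1 j.+1 ^+ 2 + g i.+1 j ^+ 2).

(** The circulation of a gradient around each inner node is zero. *)
Lemma curl_grad_orthogonal m f g :
  (forall i j, (i == 0) || (i == m) || (j == 0) || (j == m) -> g i j = 0) ->
  \sum_(i < m.-1) \sum_(j < m) (f i.+1 j - f i j) * (g i.+1 j.+1 - g i.+1 j) =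
  \sum_(j < m.-1) \sum_(i < m) (f i j.+1 - f i j) * (g i.+1 j.+1 - g i j.+1).
Proof.
move=> g0.
under eq_bigr => i _.
  rewrite (sum_by_parts (fun j => f i.+1 j - f i j) (W := g i.+1)); last 2 first.
  - by rewrite g0 ?orbT.
  - by rewrite g0 ?eqxx ?orbT.
  over.
under [RHS]eq_bigr => j _.
  rewrite (sum_by_parts (fun i => f i j.+1 - f i j) (W := fun i => g i j.+1)); last 2 first.
  - by rewrite g0 ?orbT.
  - by rewrite g0 ?eqxx ?orbT.
  over.
rewrite exchange_big /=; apply: eq_bigr => j _; apply: eq_bigr => i _.
by congr (_ * _); ring.
Qed.

(** The weight is moved from the edge to its end nodes.  As the distance is 1-Lipschitz,
    the error on its square is at most three times the distance, and Young's inequality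
    absorbs half of the left-hand side. *)
Lemma weighted_young (e n1 n0 : nat) (a g1 g0 : R) : (0 < e)%N ->
  (e <= n1.+1)%N -> (n1 <= e.+1)%N -> (e <= n0.+1)%N -> (n0 <= e.+1)%N ->
  a = g1 - g0 ->
  e%:R ^+ 2 * a ^+ 2 <=
  2 * (a * (n1%:R ^+ 2 * g1 - n0%:R ^+ 2 * g0)) + 18 * (g1 ^+ 2 + g0 ^+ 2).
Proof.
move=> e0 en1 n1e en0 n0e aE.
have diff (k : nat) (x : R) : (e <= k.+1)%N -> (k <= e.+1)%N ->
    a * ((e%:R ^+ 2 - k%:R ^+ 2) * x) <= 4^-1 * (e%:R ^+ 2 * a ^+ 2) + 9 * x ^+ 2.
  move=> h1 h2.
  have k0 : 0 <= k%:R :> R by rewrite ler0n.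
  have e1 : 1 <= e%:R :> R by rewrite ler1n.
  have h3 : e%:R <= k%:R + 1 :> R by rewrite natr1 ler_nat.
  have h4 : k%:R <= e%:R + 1 :> R by rewrite natr1 ler_nat.
  have h5 : (e%:R ^+ 2 - k%:R ^+ 2) ^+ 2 <= 9 * e%:R ^+ 2 :> R.
    have d1 : (e%:R - k%:R) ^+ 2 <= 1 :> R by nra.
    have s1 : (e%:R + k%:R) ^+ 2 <= 9 * e%:R ^+ 2 :> R by nra.
    have -> : e%:R ^+ 2 - k%:R ^+ 2 = (e%:R - k%:R) * (e%:R + k%:R) :> R by ring.
    have := ler_pM (sqr_ge0 _) (sqr_ge0 _) d1 s1; rewrite mul1r; nra.
  have h6 : (e%:R ^+ 2 - k%:R ^+ 2) ^+ 2 * a ^+ 2 <= 9 * e%:R ^+ 2 * a ^+ 2.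
    by rewrite ler_wpM2r ?sqr_ge0.
  have := sqr_ge0 (6^-1 * ((e%:R ^+ 2 - k%:R ^+ 2) * a) - 3 * x).
  by lra.
have h1 := diff n1 g1 en1 n1e; have h0 := diff n0 (- g0) en0 n0e.
have : e%:R ^+ 2 * a ^+ 2 = e%:R ^+ 2 * (a * (g1 - g0)) by rewrite -aE expr2.
by lra.
Qed.

(** One factor grad f of the weighted energy is replaced by the rotated gradient of g.
    With the weight carried by the nodes the pairing vanishes by [curl_grad_orthogonal],
    so that only the variation of the weight remains. *)
Lemma caccioppoli m f g :
  (forall i j, (i < m.-1)%N -> (j < m)%N ->
     f i.+1 j - f i j = g i.+1 j.+1 - g i.+1 j) ->
  (forall i j, (i < m)%N -> (j < m.-1)%N ->
     f i j.+1 - f i j = g i j.+1 - g i.+1 j.+1) ->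
  energy m f <= 18 * (edge_nodes m g + edge_nodes m (transpose g)).
Proof.
move=> hx hy.
pose G i j : R := (ndist m i j)%:R ^+ 2 * g i j.
have G0 i j : (i == 0) || (i == m) || (j == 0) || (j == m) -> G i j = 0.
  move=> h; rewrite /G (_ : ndist m i j = 0%N) ?expr0n ?mul0r //.
  by move: h; rewrite /ndist; lia.
have ex : xenergy m f <= 2 * (\sum_(i < m.-1) \sum_(j < m)
    (f i.+1 j - f i j) * (G i.+1 j.+1 - G i.+1 j)) + 18 * edge_nodes m g.
  rewrite /edge_nodes !mulr_sumr -big_split; apply: ler_sum => i _ /=.
  rewrite !mulr_sumr -big_split; apply: ler_sum => j _ /=.
  have iP := ltn_ord i; have jP := ltn_ord j.
  by apply: weighted_young; rewrite ?hx // /edist /ndist; lia.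
have ey : xenergy m (transpose f) <= - (2 * (\sum_(j < m.-1) \sum_(i < m)
    (f i j.+1 - f i j) * (G i.+1 j.+1 - G i j.+1))) + 18 * edge_nodes m (transpose g).
  rewrite /edge_nodes !mulr_sumr -sumrN -big_split; apply: ler_sum => i _ /=.
  rewrite !mulr_sumr -sumrN -big_split; apply: ler_sum => j _ /=.
  have iP := ltn_ord i; have jP := ltn_ord j.
  have := @weighted_young (edist m i j) (ndist m j i.+1) (ndist m j.+1 i.+1)
     (f j i.+1 - f j i) (g j i.+1) (g j.+1 i.+1).
  rewrite /G /transpose => H.
  apply: le_trans (H _ _ _ _ _ (hy _ _ _ _)) _; rewrite // /edist /ndist; try lia.
  by rewrite le_eqVlt; apply/orP; left; apply/eqP; ring.
have := curl_grad_orthogonal f G0.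
rewrite /energy => h; rewrite h in ex; lra.
Qed.

Lemma friedrichs m f g :
  (forall i j, (i < m.-1)%N -> (j < m)%N ->
     f i.+1 j - f i j = g i.+1 j.+1 - g i.+1 j) ->
  (forall i j, (i < m)%N -> (j < m.-1)%N ->
     f i j.+1 - f i j = g i j.+1 - g i.+1 j.+1) ->
  gsum m f = 0 ->
  gsum m (fun i j => f i j ^+ 2) <=
  18432 * (edge_nodes m g + edge_nodes m (transpose g)).
Proof.
move=> hx hy /improved_poincare; have := caccioppoli hx hy; lra.
Qed.

End Friedrichs.

(** * Staggered vector Laplacian *)

(** Stated for functions on a finite type, so that a linear system can be given by its
    equations instead of a matrix. *)
Lemma linear_injective_surjective (F : fieldType) (I : finType)
    (A : (I -> F) -> I -> F) :
  (forall x y, x =1 y -> A x =1 A y) ->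
  (forall k x y i, A (fun j => k * x j + y j) i = k * A x i + A y i) ->
  (forall x, A x =1 (fun=> 0) -> x =1 (fun=> 0)) ->
  forall b, exists x, A x =1 b.
Proof.
move=> Aext Alin Ainj b.
pose coef (v : 'rV[F]_#|I|) i := v ord0 (enum_rank i).
pose f (v : 'rV[F]_#|I|) : 'rV[F]_#|I| := \row_l A (coef v) (enum_val l).
have flin : linear f.
  move=> k u v; apply/rowP => l; rewrite !mxE -Alin; apply: Aext => i.
  by rewrite /coef !mxE.
pose fL : {linear 'rV[F]_#|I| -> 'rV[F]_#|I|} :=
  HB.pack f (GRing.isLinear.Build _ _ _ _ f flin).
have fE v i : (v *m lin1_mx fL) ord0 (enum_rank i) = A (coef v) i.
  by rewrite mul_rV_lin1 mxE enum_rankK.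
have Munit : lin1_mx fL \in unitmx.
  rewrite -row_free_unit; apply/inj_row_free => v v0.
  apply/rowP => l; rewrite mxE -[l]enum_valK.
  by apply: (Ainj (coef v)) => i; rewrite -fE v0 mxE.
exists (coef (\row_l b (enum_val l) *m invmx (lin1_mx fL))) => i.
by rewrite -fE mulmxKV // mxE enum_rankK.
Qed.

Section MAC.
Variable R : realFieldType.
Implicit Types (q U V W : nat -> nat -> R) (a : nat -> R) (m : nat).

Definition on_grid m (x : 'I_m * 'I_m -> R) (i j : nat) : R :=
  match insub i, insub j with Some k, Some l => x (k, l) | _, _ => 0 end.

Lemma on_gridE m (x : 'I_m * 'I_m -> R) (i j : 'I_m) : on_grid x i j = x (i, j).
Proof. by rewrite /on_grid !valK. Qed.

Lemma on_grid_lin m k (x y : 'I_m * 'I_m -> R) i j :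
  on_grid (fun K => k * x K + y K) i j = k * on_grid x i j + on_grid y i j.
Proof.
by rewrite /on_grid; case: (insub i : option 'I_m) => [a|];
   case: (insub j : option 'I_m) => [c|] //; rewrite mulr0 addr0.
Qed.

Lemma eq_on_grid m (x y : 'I_m * 'I_m -> R) i j : x =1 y -> on_grid x i j = on_grid y i j.
Proof.
by move=> e; rewrite /on_grid; case: (insub i : option 'I_m) => [a|];
   case: (insub j : option 'I_m) => [c|].
Qed.

(** Minus the Laplacian at the edge between the cells (i - 1, j) and (i, j), for the
    component U of a velocity normal to that edge.  In the transverse direction U sits at
    half a cell from the walls, hence the operator [lap1]. *)
Definition mac_laplace m U i j : R :=
  (U i j - U i.-1 j) - (U i.+1 j - U i j) + lap1 m (U i) j.

Definition mac_form m U W : R :=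
  \sum_(i < m) \sum_(j < m) (U i.+1 j - U i j) * (W i.+1 j - W i j)
  + \sum_(i < m.-1) dirichlet1 m (U i.+1) (W i.+1).

Definition no_flux m U := forall j, U 0%N j = 0 /\ U m j = 0.

Lemma mac_by_parts m q W : no_flux m W ->
  \sum_(i < m.-1) \sum_(j < m) (q i j - q i.+1 j) * W i.+1 j =
  \sum_(i < m) \sum_(j < m) q i j * (W i.+1 j - W i j).
Proof.
move=> W0; rewrite exchange_big [RHS]exchange_big /=; apply: eq_bigr => j _.
have [h0 hm] := W0 j.
by rewrite (sum_by_parts (fun i => q i j) (W := fun i => W i j)).
Qed.

Lemma sum_mac_laplace m U W : no_flux m W ->
  \sum_(i < m.-1) \sum_(j < m) mac_laplace m U i.+1 j * W i.+1 j = mac_form m U W.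
Proof.
move=> W0; rewrite /mac_form -(mac_by_parts (fun i j => U i.+1 j - U i j) W0).
rewrite -big_split; apply: eq_bigr => i _ /=.
rewrite -sum_lap1; last by have := ltn_ord i; lia.
by rewrite -big_split; apply: eq_bigr => j _; rewrite /mac_laplace /= mulrDl.
Qed.

Lemma mac_normal_ge0 m U :
  0 <= \sum_(i < m) \sum_(j < m) (U i.+1 j - U i j) * (U i.+1 j - U i j).
Proof. by do 2![apply: sumr_ge0 => ? _]; rewrite -expr2 sqr_ge0. Qed.

Lemma mac_tangent_ge0 m U : 0 <= \sum_(i < m.-1) dirichlet1 m (U i.+1) (U i.+1).
Proof. by apply: sumr_ge0 => i _; apply: dirichlet1_ge0. Qed.

Lemma mac_form_eq0 m U : mac_form m U U <= 0 ->
  forall i j, (i < m.-1)%N -> (j < m)%N -> U i.+1 j = 0.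
Proof.
move=> E0 i j im jm.
have T0 : \sum_(k < m.-1) dirichlet1 m (U k.+1) (U k.+1) = 0.
  apply/eqP; rewrite eq_le mac_tangent_ge0 andbT.
  by move: E0; have := mac_normal_ge0 m U; rewrite /mac_form; lra.
have Ti : dirichlet1 m (U i.+1) (U i.+1) = 0.
  move/eqP: T0; rewrite psumr_eq0 => [/allP/(_ (Ordinal im))|k _]; last exact: dirichlet1_ge0.
  by rewrite mem_index_enum => /(_ isT)/eqP.
have := poincare1 (n := m) (U i.+1); rewrite Ti mulr0 => /(_ _)/le_trans H.
have : \sum_(k < m) U i.+1 k ^+ 2 = 0.
  apply/eqP; rewrite eq_le H ?lexx //; last by lia.
  by apply: sumr_ge0 => k _; apply: sqr_ge0.
move/eqP; rewrite psumr_eq0 => [/allP/(_ (Ordinal jm))|k _]; last exact: sqr_ge0.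
by rewrite mem_index_enum sqrf_eq0 => /(_ isT)/eqP.
Qed.

(** The energy identity [sum_mac_laplace] gives injectivity. *)
Lemma mac_solve m (b : nat -> nat -> R) : exists2 U, no_flux m U &
  forall i j, (i < m.-1)%N -> (j < m)%N -> mac_laplace m U i.+1 j = b i j.
Proof.
pose U (x : 'I_m * 'I_m -> R) i j := if (0 < i < m)%N then on_grid x i j else 0.
have U0 x : no_flux m (U x) by move=> j; rewrite /U !ltnn andbF.
pose A x (K : 'I_m * 'I_m) := if (K.1 == 0 :> nat) then x K else mac_laplace m (U x) K.1 K.2.
have Ulin k x y i j : U (fun K => k * x K + y K) i j = k * U x i j + U y i j.
  by rewrite /U; case: ifP => _; rewrite ?on_grid_lin // mulr0 addr0.
have Uext x y i j : x =1 y -> U x i j = U y i j.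
  by move=> e; rewrite /U; case: ifP => // _; apply: eq_on_grid.
have Aext x y : x =1 y -> A x =1 A y.
  move=> e K; rewrite /A /mac_laplace /lap1 e.
  by rewrite !(Uext x y _ _ e).
have Alin k x y K : A (fun K => k * x K + y K) K = k * A x K + A y K.
  rewrite /A; case: ifP => // _.
  rewrite /mac_laplace /lap1 !Ulin.
  by case: ifP => _; case: ifP => _; ring.
have Ainj x : A x =1 (fun=> 0) -> x =1 (fun=> 0).
  move=> x0 [i j].
  have [i0|i0] := eqVneq (i : nat) 0%N; first by have := x0 (i, j); rewrite /A /= i0.
  have E0 : mac_form m (U x) (U x) = 0.
    rewrite -sum_mac_laplace //; apply: big1 => k _; apply: big1 => l _.
    have kP : (k.+1 < m)%N by have := ltn_ord k; lia.
    by have := x0 (Ordinal kP, l); rewrite /A /= => ->; rewrite mul0r.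
  have iP := ltn_ord i.
  have := @mac_form_eq0 m (U x) _ i.-1 j _ (ltn_ord j).
  rewrite E0 lexx prednK ?lt0n // => /(_ isT) <-; last by lia.
  by rewrite /U lt0n i0 iP on_gridE.
have [x xP] := linear_injective_surjective Aext Alin Ainj (fun K => b K.1.-1 K.2).
exists (U x) => // i j im jm.
have iP : (i.+1 < m)%N by lia.
by have := xP (Ordinal iP, Ordinal jm); rewrite /A.
Qed.

End MAC.

(** * Inf-sup condition on the cluster mesh *)

Section InfSup.
Variable R : realFieldType.
Implicit Types (q U V W : nat -> nat -> R) (a : nat -> R) (m : nat).

Definition fluxdiff U i j : R := U i.+1 j - U i j.

(** At both walls the value is reflected to its opposite, which encodes the no-slip
    condition at distance half a cell. *)
Definition node_slope m a (j : nat) : R :=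
  if j is j'.+1 then (if (j < m)%N then a j - a j' else - (2 * a j')) else 2 * a 0%N.

(** The transverse part of the Laplacian is a difference of nodal slopes; this is what lets
    the curl appear in the momentum equation up to the wall. *)
Lemma lap1_node_slope m a j : (j < m)%N -> lap1 m a j = node_slope m a j - node_slope m a j.+1.
Proof. by rewrite /lap1 /node_slope; case: j => [|j] /= jm; case: ifP => ?; rewrite ?jm; ring. Qed.

Lemma sum_sqr_node_slope m a : (0 < m)%N ->
  \sum_(j < m) (node_slope m a j.+1 ^+ 2 + node_slope m a j ^+ 2) = 2 * dirichlet1 m a a.
Proof.
move=> m0; rewrite /dirichlet1 -(sum_first (fun i => 2 * a i * a i) m0).
rewrite -(sum_last (fun i => 2 * a i * a i) m0).
have -> : 2 * (\sum_(i < m.-1) (a i.+1 - a i) * (a i.+1 - a i) +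
    \sum_(i < m) (if (0 < i)%N then 0 else 2 * a i * a i) +
    \sum_(i < m) (if (i.+1 < m)%N then 0 else 2 * a i * a i)) =
    (\sum_(i < m.-1) (a i.+1 - a i) ^+ 2 + \sum_(i < m.-1) (a i.+1 - a i) ^+ 2) +
    2 * (\sum_(i < m) (if (0 < i)%N then 0 else 2 * a i * a i) +
    \sum_(i < m) (if (i.+1 < m)%N then 0 else 2 * a i * a i)).
  have -> : \sum_(i < m.-1) (a i.+1 - a i) * (a i.+1 - a i) =
     \sum_(i < m.-1) (a i.+1 - a i) ^+ 2 by apply: eq_bigr => i _; rewrite expr2.
  by ring.
rewrite -{1}(sum_inner_left m (fun i => (a i - a i.-1) ^+ 2)).
rewrite -(sum_inner_right m (fun i => (a i.+1 - a i) ^+ 2)).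
rewrite -!big_split mulr_sumr -big_split; apply: eq_bigr => i _ /=.
by case: i => [[|i] im] /=; case: ifP => ? /=; rewrite ?im; ring.
Qed.

Lemma edge_nodes_sub m f g h : (forall i j, h i j = f i j - g i j) ->
  edge_nodes m h <= 2 * edge_nodes m f + 2 * edge_nodes (R := R) m g.
Proof.
move=> hE; rewrite /edge_nodes !mulr_sumr -big_split; apply: ler_sum => i _.
rewrite !mulr_sumr -big_split; apply: ler_sum => j _ /=; rewrite !hE.
have := sqr_ge0 (f i.+1 j.+1 + g i.+1 j.+1); have := sqr_ge0 (f i.+1 j + g i.+1 j).
by lra.
Qed.

Definition tangential_part m U : R := \sum_(i < m.-1) dirichlet1 m (U i.+1) (U i.+1).
Definition normal_part m U : R := gsum m (fun i j => fluxdiff U i j ^+ 2).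

Lemma mac_formE m U : mac_form m U U = normal_part m U + tangential_part m U.
Proof. by congr (_ + _); apply: eq_bigr => i _; apply: eq_bigr => j _; rewrite expr2. Qed.

Lemma edge_nodes_node_slope m U : (0 < m)%N ->
  edge_nodes m (fun i => node_slope m (U i)) = 2 * tangential_part m U.
Proof.
by move=> m0; rewrite /edge_nodes /tangential_part mulr_sumr; apply: eq_bigr => i _;
   rewrite sum_sqr_node_slope.
Qed.

Lemma edge_nodes_node_slope_transpose m V : (0 < m)%N -> no_flux m V ->
  edge_nodes m (fun i j => node_slope m (V j) i) <= 2 * tangential_part m V.
Proof.
move=> m0 V0; pose D j := \sum_(i < m.-1) (V j i.+1 - V j i) ^+ 2.
have D0 j : 0 <= D j by apply: sumr_ge0 => i _; apply: sqr_ge0.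
have Dd j : D j <= dirichlet1 m (V j) (V j).
  rewrite /dirichlet1 /D; under eq_bigr do rewrite expr2.
  by rewrite -addrA lerDl -!mulrA -!expr2 -mulrDr mulr_ge0 ?addr_ge0 ?sqr_ge0.
have -> : edge_nodes m (fun i j => node_slope m (V j) i) = \sum_(j < m) D j.+1 + \sum_(j < m) D j.
  rewrite /edge_nodes exchange_big /= -big_split; apply: eq_bigr => j _.
  rewrite -big_split; apply: eq_bigr => i _ /=.
  by have -> : (i.+1 < m)%N by have := ltn_ord i; lia.
have Dz j : (forall i, V j i = 0) -> D j = 0.
  by move=> z; apply: big1 => i _; rewrite !z subrr expr0n.
have e0 : \sum_(j < m) D j = \sum_(j < m.-1) D j.+1.
  case: m m0 V0 D D0 Dd Dz => // m m0 V0 D D0 Dd Dz; rewrite big_ord_recl.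
  by rewrite Dz ?add0r // => i; case: (V0 i).
have e1 : \sum_(j < m) D j.+1 = \sum_(j < m.-1) D j.+1.
  case: m m0 V0 D D0 Dd Dz e0 => // m m0 V0 D D0 Dd Dz e0; rewrite big_ord_recr.
  by rewrite /= Dz ?addr0 // => i; case: (V0 i).
rewrite e0 e1.
have : \sum_(j < m.-1) D j.+1 <= tangential_part m V by apply: ler_sum => j _; apply: Dd.
by lra.
Qed.

Lemma gsum_fluxdiff m U : no_flux m U -> gsum m (fluxdiff U) = 0.
Proof.
move=> U0; rewrite -gsum_transpose; apply: big1 => j _.
have [h0 hm] := U0 j.
have := sum_by_parts (fun=> 1) (W := fun i => U i j) h0 hm.
under eq_bigr do rewrite mul1r.
by move=> ->; apply: big1 => i _; rewrite subrr mul0r.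
Qed.

(** V is stored with its own flow direction as first index, so that both components solve
    the same scalar problem, for q and for its transpose.  Their equations say that
    q - div and curl are conjugate in the sense of [friedrichs]. *)
Lemma coarse_inf_sup m q : (0 < m)%N -> gsum m q = 0 -> exists U V,
  [/\ no_flux m U, no_flux m V,
      gsum m (fun i j => q i j * (fluxdiff U i j + fluxdiff V j i)) =
        mac_form m U U + mac_form m V V
    & gsum m (fun i j => q i j ^+ 2) <=
        (450 * 1000) * (mac_form m U U + mac_form m V V)].
Proof.
move=> m0 q0.
have [U U0 eU] := mac_solve m (fun i j => q i j - q i.+1 j).
have [V V0 eV] := mac_solve m (fun i j => q j i - q j i.+1).
exists U, V; split => //.
  have -> : gsum m (fun i j => q i j * (fluxdiff U i j + fluxdiff V j i)) =
      gsum m (fun i j => q i j * fluxdiff U i j)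
      + gsum m (transpose (fun i j => q j i * fluxdiff V i j)).
    by rewrite -gsumD; apply: eq_gsum => i j _ _; rewrite mulrDr.
  rewrite gsum_transpose; congr (_ + _).
    rewrite -sum_mac_laplace // /gsum -mac_by_parts //.
    by apply: eq_bigr => i _; apply: eq_bigr => j _; rewrite eU.
  rewrite -sum_mac_laplace // /gsum -(mac_by_parts (fun i j => q j i)) //.
  by apply: eq_bigr => i _; apply: eq_bigr => j _; rewrite eV.
pose f i j := q i j - (fluxdiff U i j + fluxdiff V j i).
pose g i j := node_slope m (U i) j - node_slope m (V j) i.
have hx i j : (i < m.-1)%N -> (j < m)%N -> f i.+1 j - f i j = g i.+1 j.+1 - g i.+1 j.
  move=> im jm; have iP : (i.+1 < m)%N by lia.
  have := eU i j im jm; rewrite /mac_laplace lap1_node_slope // /f /g /fluxdiff /=.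
  by rewrite iP; lra.
have hy i j : (i < m)%N -> (j < m.-1)%N -> f i j.+1 - f i j = g i j.+1 - g i.+1 j.+1.
  move=> im jm; have jP : (j.+1 < m)%N by lia.
  have := eV j i jm im; rewrite /mac_laplace lap1_node_slope // /f /g /fluxdiff /=.
  by rewrite jP; lra.
have f0 : gsum m f = 0.
  have : gsum m q = gsum m f + (gsum m (fluxdiff U) + gsum m (transpose (fluxdiff V))).
    by rewrite -!gsumD; apply: eq_gsum => i j _ _; rewrite /f /transpose; ring.
  by rewrite gsum_transpose !gsum_fluxdiff // q0 !addr0.
have := friedrichs hx hy f0.
have g1 : edge_nodes m g <= 4 * (tangential_part m U + tangential_part m V).
  have := @edge_nodes_sub m (fun i j => node_slope m (U i) j)
     (fun i j => node_slope m (V j) i) g (fun _ _ => erefl).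
  have := edge_nodes_node_slope U m0; have := edge_nodes_node_slope_transpose m0 V0; lra.
have g2 : edge_nodes m (transpose g) <= 4 * (tangential_part m U + tangential_part m V).
  have := @edge_nodes_sub m (fun i j => node_slope m (U j) i) (fun i j => node_slope m (V i) j)
     (transpose g) (fun _ _ => erefl).
  have := edge_nodes_node_slope V m0; have := edge_nodes_node_slope_transpose m0 U0; lra.
have q3 : gsum m (fun i j => q i j ^+ 2) <=
    3 * (gsum m (fun i j => f i j ^+ 2) + (normal_part m U + normal_part m V)).
  rewrite /normal_part -[X in _ + (_ + X)]gsum_transpose -!gsumD -gsumZ.
  apply: le_gsum => i j _ _; rewrite /transpose /f.
  move: (fluxdiff U i j) (fluxdiff V j i) (q i j) => x y z.
  have := sqr_ge0 (z - x - y - x); have := sqr_ge0 (z - x - y - y).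
  by have := sqr_ge0 (x - y); lra.
rewrite !mac_formE.
have nU : 0 <= normal_part m U by apply: gsum_ge0 => *; apply: sqr_ge0.
have nV : 0 <= normal_part m V by apply: gsum_ge0 => *; apply: sqr_ge0.
have tU := mac_tangent_ge0 m U; have tV := mac_tangent_ge0 m V.
rewrite -/(tangential_part m U) in tU; rewrite -/(tangential_part m V) in tV.
by lra.
Qed.

End InfSup.

(** * Fine mesh, clusters and prolongation *)

Section Fine.
Variable R : realFieldType.
Implicit Types (q u v w P U V W : nat -> nat -> R) (a b c : nat -> R) (m n : nat).

Lemma gsum_block m (f : nat -> nat -> R) :
  gsum m.*2 f = gsum m (fun i j => f i.*2 j.*2 + f i.*2 j.*2.+1
                                  + f i.*2.+1 j.*2 + f i.*2.+1 j.*2.+1).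
Proof.
rewrite /gsum (sum_even_odd m (fun i => \sum_(j < m.*2) f i j)).
apply: eq_bigr => i _; rewrite (sum_even_odd m (f i.*2)) (sum_even_odd m (f i.*2.+1)).
by rewrite -big_split; apply: eq_bigr => j _ /=; rewrite !addrA.
Qed.

Lemma dirichlet1_prolong_normal m a : (0 < m)%N -> a 0%N = 0 -> a m = 0 ->
  dirichlet1 m.*2 (fun k => a (uphalf k)) (fun k => a (uphalf k)) =
  \sum_(i < m) (a i.+1 - a i) ^+ 2.
Proof.
move=> m0 a0 am; rewrite /dirichlet1 (_ : uphalf m.*2.-1 = m); last by lia.
rewrite a0 am !mulr0 !addr0.
pose F k := (a (uphalf k.+1) - a (uphalf k)) * (a (uphalf k.+1) - a (uphalf k)).
rewrite -(sum_inner_right m.*2 F).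
rewrite (sum_even_odd m (fun k => if (k.+1 < m.*2)%N then F k else 0)).
apply: eq_bigr => i _; rewrite /F /=; rewrite doubleK uphalf_double subrr mul0r.
have -> : (i.*2.+1 < m.*2)%N by have := ltn_ord i; lia.
by rewrite (fun_if) if_same addr0 expr2.
Qed.

Lemma dirichlet1_prolong_tangent m b : (0 < m)%N ->
  dirichlet1 m.*2 (fun l => b l./2) (fun l => b l./2) = dirichlet1 m b b.
Proof.
move=> m0; rewrite /dirichlet1 (_ : m.*2.-1./2 = m.-1)%N; last by lia.
congr (_ + _ + _).
pose F k := (b k.+1./2 - b k./2) * (b k.+1./2 - b k./2).
rewrite -(sum_inner_right m.*2 F).
rewrite (sum_even_odd m (fun k => if (k.+1 < m.*2)%N then F k else 0)).
rewrite -(sum_inner_right m (fun k => (b k.+1 - b k) * (b k.+1 - b k))).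
apply: eq_bigr => i _; rewrite /F /=; rewrite doubleK uphalf_double subrr mul0r if_same add0r.
by rewrite -doubleS ltn_double.
Qed.

Lemma div1_prolong m c a : a 0%N = 0 -> a m = 0 ->
  \sum_(k < m.*2) c k./2 * div1 m.*2 (fun k => a (uphalf k)) k =
  \sum_(i < m) c i * (a i.+1 - a i).
Proof.
move=> a0 am; rewrite (sum_even_odd m (fun k => c k./2 * div1 m.*2 (fun k => a (uphalf k)) k)).
apply: eq_bigr => i _; have im := ltn_ord i.
rewrite /div1 /= uphalf_double doubleK -doubleS ltn_double double_gt0.
have -> : (i.*2.+1 < m.*2)%N by lia.
have left : (if (0 < i)%N then (a i + a (uphalf i.*2.-1)) / 2 else 0) = a i.
  case: (posnP i) => [->|i0]; first by rewrite a0.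
  by rewrite (_ : uphalf i.*2.-1 = i); [field | lia].
have right : (if (i.+1 < m)%N then (a i.+1 + a i.+1) / 2 else 0) = a i.+1.
  case: ltnP => mi; first by field.
  by rewrite (_ : i.+1 = m) ?am //; lia.
by rewrite left right; field.
Qed.

Definition lap2 n u i j : R := lap1 n (fun k => u k j) i + lap1 n (u i) j.

Definition dirichlet n u v : R :=
  \sum_(j < n) dirichlet1 n (fun k => u k j) (fun k => v k j)
  + \sum_(i < n) dirichlet1 n (u i) (v i).

Definition divx n u i j : R := div1 n (fun k => u k j) i.
Definition gradx n P i j : R := grad1 n (fun k => P k j) i.

Lemma dirichlet_transpose n u : dirichlet n (transpose u) (transpose u) = dirichlet n u u.
Proof. by rewrite /dirichlet addrC. Qed.

Lemma gsum_lap2 n u v : (0 < n)%N ->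
  gsum n (fun i j => lap2 n u i j * v i j) = dirichlet n u v.
Proof.
move=> n0; have -> : gsum n (fun i j => lap2 n u i j * v i j) =
    gsum n (fun i j => lap1 n (fun k => u k j) i * v i j)
    + gsum n (fun i j => lap1 n (u i) j * v i j).
  by rewrite -gsumD; apply: eq_gsum => i j _ _; rewrite /lap2 mulrDl.
congr (_ + _).
  rewrite /gsum exchange_big; apply: eq_bigr => j _.
  exact: (sum_lap1 (fun k => u k j) (fun k => v k j) n0).
by apply: eq_bigr => i _; apply: sum_lap1.
Qed.

Lemma gsum_gradx n P u : (0 < n)%N ->
  gsum n (fun i j => gradx n P i j * u i j) =
  - gsum n (fun i j => P i j * divx n u i j).
Proof.
move=> n0; rewrite /gsum exchange_big [in RHS]exchange_big /= -sumrN.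
apply: eq_bigr => j _.
exact: (sum_grad1 (fun k => P k j) (fun k => u k j) n0).
Qed.

Lemma gsum_sqr_divx n u : (0 < n)%N ->
  gsum n (fun i j => divx n u i j ^+ 2) <= dirichlet n u u.
Proof.
move=> n0; rewrite /gsum exchange_big /=.
apply: (@le_trans _ _ (\sum_(j < n) dirichlet1 n (fun k => u k j) (fun k => u k j))).
  by apply: ler_sum => j _; apply: sum_sqr_div1.
by rewrite lerDl sumr_ge0 // => i _; apply: dirichlet1_ge0.
Qed.

Lemma poincare2 n u : (0 < n)%N ->
  gsum n (fun i j => u i j ^+ 2) <= n%:R ^+ 2 * dirichlet n u u.
Proof.
move=> n0; rewrite /dirichlet mulrDr.
apply: (@le_trans _ _ (n%:R ^+ 2 * \sum_(i < n) dirichlet1 n (u i) (u i))).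
  by rewrite mulr_sumr; apply: ler_sum => i _; apply: poincare1.
rewrite lerDr mulr_ge0 ?sqr_ge0 // sumr_ge0 // => j _; exact: dirichlet1_ge0.
Qed.

Lemma dirichlet_young n u v : dirichlet n u v <= 2 * dirichlet n u u + 8^-1 * dirichlet n v v.
Proof.
have young (x y : R) : x * y <= 2 * (x * x) + 8^-1 * (y * y).
  by have := sqr_ge0 (4 * x - y); lra.
have yd a b : dirichlet1 n a b <= 2 * dirichlet1 n a a + 8^-1 * dirichlet1 n b b.
  have h : \sum_(i < n.-1) (a i.+1 - a i) * (b i.+1 - b i) <=
     2 * (\sum_(i < n.-1) (a i.+1 - a i) * (a i.+1 - a i))
     + 8^-1 * (\sum_(i < n.-1) (b i.+1 - b i) * (b i.+1 - b i)).
    by rewrite !mulr_sumr -big_split; apply: ler_sum => i _; apply: young.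
  have := young (a 0%N) (b 0%N); have := young (a n.-1) (b n.-1).
  by rewrite /dirichlet1; lra.
have h1 : \sum_(j < n) dirichlet1 n (fun k => u k j) (fun k => v k j) <=
   2 * (\sum_(j < n) dirichlet1 n (fun k => u k j) (fun k => u k j))
   + 8^-1 * (\sum_(j < n) dirichlet1 n (fun k => v k j) (fun k => v k j)).
  by rewrite !mulr_sumr -big_split; apply: ler_sum => i _; apply: yd.
have h2 : \sum_(j < n) dirichlet1 n (u j) (v j) <=
   2 * (\sum_(j < n) dirichlet1 n (u j) (u j)) + 8^-1 * (\sum_(j < n) dirichlet1 n (v j) (v j)).
  by rewrite !mulr_sumr -big_split; apply: ler_sum => i _; apply: yd.
by rewrite /dirichlet; lra.
Qed.

(** The factor n^2, the square of the side in cells, is the Poincare constant. *)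
Lemma work_young n (k : R) u v : (0 < n)%N -> 0 < k ->
  gsum n (fun i j => u i j * v i j) <=
  k / 2 * (n%:R ^+ 2 * gsum n (fun i j => u i j ^+ 2)) + (2 * k)^-1 * dirichlet n v v.
Proof.
move=> n0 k0; have N0 : 0 < n%:R :> R by rewrite ltr0n.
have := poincare2 v n0; rewrite mulrC -ler_pdivrMr ?exprn_gt0 // => h.
apply: (@le_trans _ _ (k / 2 * (n%:R ^+ 2 * gsum n (fun i j => u i j ^+ 2))
   + (2 * k)^-1 * (gsum n (fun i j => v i j ^+ 2) / n%:R ^+ 2))); last first.
  by rewrite lerD2l ler_wpM2l // invr_ge0; lra.
have -> : k / 2 * (n%:R ^+ 2 * gsum n (fun i j => u i j ^+ 2))
    + (2 * k)^-1 * (gsum n (fun i j => v i j ^+ 2) / n%:R ^+ 2) =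
    gsum n (fun i j => k / 2 * n%:R ^+ 2 * u i j ^+ 2
      + (2 * k)^-1 / n%:R ^+ 2 * v i j ^+ 2).
  by rewrite gsumD !gsumZ; ring.
apply: le_gsum => i j _ _.
set x := u i j; set y := v i j.
have -> : x * y = (k * n%:R * x) * (y / (k * n%:R)).
  by field; rewrite !lt0r_neq0.
have h2 := sqr_ge0 (k * n%:R * x - y / n%:R).
have -> : k / 2 * n%:R ^+ 2 * x ^+ 2 + (2 * k)^-1 / n%:R ^+ 2 * y ^+ 2 =
   k * n%:R * x * (y / (k * n%:R)) + (2 * k)^-1 * (k * n%:R * x - y / n%:R) ^+ 2.
  by field; rewrite !lt0r_neq0.
by rewrite lerDl mulr_ge0 // invr_ge0; lra.
Qed.

Definition cluster_lap P i j : R := (P i j - P (mate i) j) + (P i j - P i (mate j)).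

Definition cluster_jumps m P : R :=
  gsum m (fun i j =>
    (P i.*2.+1 j.*2 - P i.*2 j.*2) ^+ 2 + (P i.*2.+1 j.*2.+1 - P i.*2 j.*2.+1) ^+ 2
  + (P i.*2 j.*2.+1 - P i.*2 j.*2) ^+ 2 + (P i.*2.+1 j.*2.+1 - P i.*2.+1 j.*2) ^+ 2).

Lemma gsum_cluster_lap m P :
  gsum m.*2 (fun i j => cluster_lap P i j * P i j) = cluster_jumps m P.
Proof.
rewrite gsum_block; apply: eq_gsum => i j _ _.
by rewrite /cluster_lap /mate /= !odd_double /=; ring.
Qed.

Definition cluster_mean P i j : R :=
  (P i.*2 j.*2 + P i.*2 j.*2.+1 + P i.*2.+1 j.*2 + P i.*2.+1 j.*2.+1) / 4.

Definition refine q i j : R := q i./2 j./2.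

Lemma gsum_refine m q : gsum m.*2 (refine q) = 4 * gsum m q.
Proof.
rewrite gsum_block -gsumZ; apply: eq_gsum => i j _ _.
by rewrite /refine /= !uphalf_double !doubleK; ring.
Qed.

(** The graph of a cluster is a cycle of length four, whose Laplacian has spectral gap
    two. *)
Lemma cluster_deviation m P :
  gsum m.*2 (fun i j => (refine (cluster_mean P) i j - P i j) ^+ 2) <=
  cluster_jumps m P.
Proof.
rewrite gsum_block; apply: le_gsum => i j _ _.
rewrite /refine /= !uphalf_double !doubleK /cluster_mean.
move: (P _ _) (P _ _) (P _ _) (P _ _) => x y z t.
have := sqr_ge0 (x - y + (t - z)); have := sqr_ge0 (x - z + (t - y)).
have := sqr_ge0 (x + y - z - t); have := sqr_ge0 (x - y + z - t).
by have := sqr_ge0 (x - y - z + t); lra.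
Qed.

(** Each edge value is copied to the cells on both sides of the edge, so that their
    average, which is what the centred divergence uses, is again the edge value. *)
Definition prolong U i j : R := U (uphalf i) j./2.

Lemma dirichlet_prolong m U : (0 < m)%N -> no_flux m U ->
  dirichlet m.*2 (prolong U) (prolong U) = 2 * mac_form m U U.
Proof.
move=> m0 U0; rewrite mac_formE mulrDr; congr (_ + _).
  rewrite (sum_even_odd m (fun j =>
    dirichlet1 m.*2 (fun k => prolong U k j) (fun k => prolong U k j))).
  rewrite -[normal_part _ _]gsum_transpose mulr_sumr; apply: eq_bigr => j _.
  have [h0 hm] := U0 j.
  rewrite /prolong /= uphalf_double doubleK.
  by rewrite (dirichlet1_prolong_normal (a := fun i => U i j)) // /transpose /fluxdiff; ring.
rewrite (sum_even_odd m (fun i => dirichlet1 m.*2 (prolong U i) (prolong U i))).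
rewrite /prolong /=; under eq_bigr => i _ do
  rewrite uphalf_double doubleK !dirichlet1_prolong_tangent //.
have z b : (forall j, b j = 0) -> dirichlet1 m b b = 0.
  by move=> b0; rewrite /dirichlet1 !b0 big1 ?mulr0 ?addr0 // => i _; rewrite !b0 subrr mul0r.
rewrite /tangential_part; case: m m0 U0 z => // m m0 U0 z.
rewrite big_split /= [X in X + _]big_ord_recl [X in _ + X]big_ord_recr /=.
rewrite !z ?add0r ?addr0; first by rewrite -mulr2n mulr_natl.
  by move=> j; case: (U0 j).
by move=> j; case: (U0 j).
Qed.

(** Inside a cluster the centred fluxes cancel; only the fluxes through its sides are
    left. *)
Lemma divx_prolong m q U : no_flux m U ->
  gsum m.*2 (fun i j => refine q i j * divx m.*2 (prolong U) i j) =
  2 * gsum m (fun i j => q i j * fluxdiff U i j).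
Proof.
move=> U0; rewrite /gsum exchange_big [in RHS]exchange_big /=.
rewrite (sum_even_odd m (fun j => \sum_(i < m.*2) refine q i j * divx m.*2 (prolong U) i j)).
rewrite mulr_sumr; apply: eq_bigr => j _; have [h0 hm] := U0 j.
rewrite /refine /divx /prolong /= uphalf_double doubleK.
by rewrite (div1_prolong (fun i => q i j) (a := fun i => U i j)) // /fluxdiff; ring.
Qed.

End Fine.

(** * A priori estimate *)

Section Stability.
Variable R : realFieldType.

(** P is h times the pressure, F and G are h^2 times the components of the force. *)
Definition stokes_scheme (lambda : R) n (u v P F G : nat -> nat -> R) : Prop :=
  forall i j, (i < n)%N -> (j < n)%N ->
  [/\ lap2 n u i j + gradx n P i j = F i j,
      lap2 n v i j + gradx n (transpose P) j i = G i j
    & divx n u i j + divx n (transpose v) j i + lambda * cluster_lap P i j = 0].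

Variables (lambda : R) (m : nat) (u v P F G : nat -> nat -> R).
Hypotheses (m0 : (0 < m)%N) (lambda0 : 0 < lambda).
Hypotheses (eqs : stokes_scheme lambda m.*2 u v P F G) (P0 : gsum m.*2 P = 0).

Let n := m.*2.
Let n0 : (0 < n)%N. Proof. by rewrite /n double_gt0. Qed.
Let data := n%:R ^+ 2 * (gsum n (fun i j => F i j ^+ 2) + gsum n (fun i j => G i j ^+ 2)).

Lemma momentum_weak w z :
  dirichlet n u w + dirichlet n v z
  = gsum n (fun i j => F i j * w i j) + gsum n (fun i j => G i j * z i j)
  + gsum n (fun i j => P i j * (divx n w i j + divx n (transpose z) j i)).
Proof.
have -> : gsum n (fun i j => F i j * w i j) =
    gsum n (fun i j => lap2 n u i j * w i j) + gsum n (fun i j => gradx n P i j * w i j).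
  rewrite -gsumD; apply: eq_gsum => i j im jm; have [<- _ _] := eqs im jm.
  by rewrite mulrDl.
have -> : gsum n (fun i j => G i j * z i j) =
    gsum n (fun i j => lap2 n v i j * z i j)
    + gsum n (fun i j => gradx n (transpose P) i j * transpose z i j).
  rewrite -[X in _ = _ + X]gsum_transpose -gsumD.
  apply: eq_gsum => i j im jm; have [_ <- _] := eqs im jm.
  by rewrite mulrDl.
have -> : gsum n (fun i j => P i j * (divx n w i j + divx n (transpose z) j i)) =
    gsum n (fun i j => P i j * divx n w i j)
    + gsum n (fun i j => transpose P i j * divx n (transpose z) i j).
  rewrite -[X in _ = _ + X]gsum_transpose -gsumD; by apply: eq_gsum => i j im jm; rewrite mulrDr.
by rewrite !gsum_gradx // !gsum_lap2 //; ring.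
Qed.

(** The pressure work cancels against the mass balance and leaves the jumps inside the
    clusters. *)
Lemma energy_bound :
  dirichlet n u u + dirichlet n v v + 2 * lambda * cluster_jumps m P <= data.
Proof.
have := momentum_weak u v.
have -> : gsum n (fun i j => P i j * (divx n u i j + divx n (transpose v) j i)) =
    - lambda * cluster_jumps m P.
  rewrite -gsum_cluster_lap -gsumZ; apply: eq_gsum => i j im jm.
  have [_ _ h] := eqs im jm; have -> : divx n u i j + divx n (transpose v) j i =
    - (lambda * cluster_lap P i j) by rewrite /n; lra.
  by ring.
have := work_young F u n0 ltr01; have := work_young G v n0 ltr01.
by rewrite /data; lra.
Qed.

(** The momentum balance is tested with the prolonged velocity that realizes the inf-sup
    condition for the cluster means; the difference between P and these means is paid by
    the jumps. *)
Lemma pressure_bound :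
  gsum n (fun i j => P i j ^+ 2) <= 16 * 1000 ^+ 2 * (data + cluster_jumps m P).
Proof.
set J := cluster_jumps m P; pose Q := cluster_mean P.
have J0 : 0 <= J by apply: gsum_ge0 => i j _ _; rewrite !addr_ge0 ?sqr_ge0.
have Q0 : gsum m Q = 0.
  have : gsum n P = 4 * gsum m Q.
    rewrite gsum_block -gsumZ; apply: eq_gsum => i j _ _.
    by rewrite /Q /cluster_mean; field.
  by rewrite P0; lra.
have [U [V [U0 V0 QE Qle]]] := coarse_inf_sup m0 Q0.
set E := mac_form m U U + mac_form m V V in QE Qle.
pose w := prolong U; pose z := transpose (prolong V).
have wE : dirichlet n w w = 2 * mac_form m U U by exact: dirichlet_prolong.
have zE : dirichlet n z z = 2 * mac_form m V V by rewrite dirichlet_transpose dirichlet_prolong.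
pose D i j := divx n w i j + divx n (transpose z) j i.
have QD : gsum n (fun i j => refine Q i j * D i j) = 2 * E.
  rewrite -QE.
  have -> : gsum n (fun i j => refine Q i j * D i j) =
     gsum n (fun i j => refine Q i j * divx n w i j) +
     gsum n (transpose (fun i j => refine (transpose Q) i j * divx n (prolong V) i j)).
    by rewrite -gsumD; apply: eq_gsum => i j _ _; rewrite /D mulrDr.
  rewrite gsum_transpose !divx_prolong // -mulrDr; congr (_ * _).
  rewrite -[X in _ + X = _]gsum_transpose -gsumD.
  by apply: eq_gsum => i j _ _; rewrite [RHS]mulrDr.
have D2 : gsum n (fun i j => D i j ^+ 2) <= 4 * E.
  apply: (@le_trans _ _ (2 * (gsum n (fun i j => divx n w i j ^+ 2) +
     gsum n (transpose (fun i j => divx n (prolong V) i j ^+ 2))))).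
    rewrite -gsumD -gsumZ; apply: le_gsum => i j _ _; rewrite /D /transpose.
    have := sqr_ge0 (divx n w i j - divx n (transpose z) j i).
    by rewrite /z /transpose; lra.
  rewrite gsum_transpose /E; have := gsum_sqr_divx w n0; rewrite wE.
  have := gsum_sqr_divx (prolong V) n0; rewrite dirichlet_prolong //; lra.
have dev := cluster_deviation m P; rewrite -/J in dev.
have gap : gsum n (fun i j => (refine Q i j - P i j) * D i j) <= 4 * J + 4^-1 * E.
  apply: (@le_trans _ _ (4 * gsum n (fun i j => (refine Q i j - P i j) ^+ 2)
     + 16^-1 * gsum n (fun i j => D i j ^+ 2))); last by rewrite /n in D2 *; lra.
  rewrite -!gsumZ -gsumD; apply: le_gsum => i j _ _.
  by have := sqr_ge0 (8 * (refine Q i j - P i j) - D i j); lra.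
have split_QD : gsum n (fun i j => refine Q i j * D i j) =
    gsum n (fun i j => P i j * D i j) + gsum n (fun i j => (refine Q i j - P i j) * D i j).
  by rewrite -gsumD; apply: eq_gsum => i j _ _; ring.
have weak : dirichlet n u w + dirichlet n v z =
    gsum n (fun i j => F i j * w i j) + gsum n (fun i j => G i j * z i j)
    + gsum n (fun i j => P i j * D i j) by exact: momentum_weak.
have yu := dirichlet_young n u w; have yv := dirichlet_young n v z.
have opp (f g : nat -> nat -> R) : - gsum n (fun i j => f i j * g i j) =
    gsum n (fun i j => - f i j * g i j).
  by rewrite -mulN1r -gsumZ; apply: eq_gsum => i j _ _; ring.
have sq (f : nat -> nat -> R) : gsum n (fun i j => (- f i j) ^+ 2) = gsum n (fun i j => f i j ^+ 2).
  by apply: eq_gsum => i j _ _; rewrite sqrrN.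
have k4 : 0 < 4 :> R by [].
have yF := work_young (fun i j => - F i j) w n0 k4.
have yG := work_young (fun i j => - G i j) z n0 k4.
rewrite -opp sq in yF; rewrite -opp sq in yG.
have en := energy_bound; rewrite -/J in en.
have lJ : 0 <= 2 * lambda * J by rewrite mulr_ge0 // mulr_ge0 // ltW.
have dE : data = n%:R ^+ 2 * gsum n (fun i j => F i j ^+ 2)
   + n%:R ^+ 2 * gsum n (fun i j => G i j ^+ 2) by rewrite /data mulrDr.
have data0 : 0 <= data.
  by apply: mulr_ge0; rewrite ?sqr_ge0 ?addr_ge0 // gsum_ge0 // => *; apply: sqr_ge0.
(* The viscous term, the force and the pressure jumps each take back at most one eighth of
   2 E, the squared norm of the test velocity. *)
have EJ : E <= 4 * (data + J).
  by rewrite wE in yF yu; rewrite zE in yG yv; rewrite /E in QD gap *; lra.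
have P2 : gsum n (fun i j => P i j ^+ 2) <=
   2 * gsum n (fun i j => (refine Q i j - P i j) ^+ 2)
   + 2 * gsum n (refine (fun i j => Q i j ^+ 2)).
  rewrite -!gsumZ -gsumD; apply: le_gsum => i j _ _; rewrite /refine.
  by have := sqr_ge0 (2 * Q i./2 j./2 - P i j); lra.
rewrite gsum_refine in P2.
rewrite -/n -/Q in dev.
lra.
Qed.

End Stability.

Definition stability_constant (R : realFieldType) (lambda : R) : R :=
  1 + 16 * 1000 ^+ 2 * (1 + (2 * lambda)^-1).

Lemma stokes_stable (R : realFieldType) (lambda : R) n (u v P F G : nat -> nat -> R) :
  0 < lambda -> (0 < n)%N -> ~~ odd n ->
  stokes_scheme lambda n u v P F G -> gsum n P = 0 ->
  dirichlet n u u + dirichlet n v v + gsum n (fun i j => P i j ^+ 2) <=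
  stability_constant lambda *
  (n%:R ^+ 2 * (gsum n (fun i j => F i j ^+ 2) + gsum n (fun i j => G i j ^+ 2))).
Proof.
move=> lambda0 n0 even_n.
have [m nE] : exists m, n = m.*2 by exists n./2; lia.
subst n => eqs P0; have m0 : (0 < m)%N by rewrite -double_gt0.
have := energy_bound m0 eqs; have := pressure_bound m0 lambda0 eqs P0.
set D := _ ^+ 2 * (gsum _ _ + gsum _ _); set J := cluster_jumps _ _ => hp he.
have J0 : 0 <= J by apply: gsum_ge0 => i j _ _; rewrite !addr_ge0 ?sqr_ge0.
have D0 : 0 <= D.
  by rewrite /D mulr_ge0 ?sqr_ge0 // addr_ge0 // gsum_ge0 // => *; apply: sqr_ge0.
have L0 : 0 <= 2 * lambda * J by rewrite mulr_ge0 // mulr_ge0 // ltW.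
have a0 w : 0 <= dirichlet m.*2 w w :> R.
  by rewrite /dirichlet addr_ge0 // sumr_ge0 // => *; exact: dirichlet1_ge0.
have JD : J <= (2 * lambda)^-1 * D.
  rewrite mulrC ler_pdivlMr ?mulr_gt0 // mulrC.
  by have := a0 u; have := a0 v; lra.
rewrite /stability_constant; lra.
Qed.

(** * Operators of the scheme in index form *)

Section Bridge.
Variables (R : realType) (n : nat).
Implicit Types (K L : cell n) (v p : XT R n) (u : XT2 R n).

Definition axis1 : 'I_2 := lift ord0 ord0.

Lemma sum_axes (F : 'I_2 -> R) : \sum_(d : 'I_2) F d = F ord0 + F axis1.
Proof. by rewrite big_ord_recl big_ord1. Qed.

Lemma sum_sides (F : side -> R) : \sum_(s : side) F s =
  (F (ord0, false) + F (ord0, true)) + (F (axis1, false) + F (axis1, true)).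
Proof.
rewrite (eq_bigr (fun s => F (s.1, s.2))) => [|[]//].
rewrite -(pair_bigA _ (fun d b => F (d, b))) sum_axes !big_bool /=.
by congr (_ + _); apply: addrC.
Qed.

Lemma sum_cells (F : nat -> nat -> R) : \sum_(K : cell n) F K.1 K.2 = gsum n F.
Proof. by rewrite -(pair_bigA _ (fun i j : 'I_n => F i j)). Qed.

Lemma forall_axes (P : pred 'I_2) : [forall d, P d] = P ord0 && P axis1.
Proof.
apply/forallP/andP => [h|[h0 h1] d]; first by split.
by case: (unliftP ord0 d) => [k ->|-> //]; rewrite (ord1 k).
Qed.

Lemma sum_at (i j : nat) (g : nat -> nat -> R) :
  \sum_(L : cell n | (L.1 == i :> nat) && (L.2 == j :> nat)) g L.1 L.2 =
  if (i < n)%N && (j < n)%N then g i j else 0.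
Proof.
case: ifP => [/andP[im jm]|out].
  rewrite (big_pred1 (Ordinal im, Ordinal jm)) //.
apply: big1 => -[a b] /= /andP[/eqP ai /eqP bj].
by rewrite -ai -bj !ltn_ord in out.
Qed.

Lemma sum_across K (s : side) (g : nat -> nat -> R) :
  \sum_(L | across s K L) g L.1 L.2 =
  if s.1 == ord0 then
    if s.2 then (if (K.1.+1 < n)%N then g K.1.+1 K.2 else 0)
    else (if (0 < K.1)%N then g K.1.-1 K.2 else 0)
  else
    if s.2 then (if (K.2.+1 < n)%N then g K.1 K.2.+1 else 0)
    else (if (0 < K.2)%N then g K.1 K.2.-1 else 0).
Proof.
have pred_at (x y : nat) : across s K =1 (fun L => (L.1 == x :> nat) && (L.2 == y :> nat)) ->
   \sum_(L | across s K L) g L.1 L.2 = if (x < n)%N && (y < n)%N then g x y else 0.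
  by move=> e; rewrite (eq_bigl _ _ e) sum_at.
case: s pred_at => d b; case: (unliftP ord0 d) => [k ->|->];
  rewrite ?(ord1 k) /=; case: b => pred_at.
- rewrite (pred_at K.1 K.2.+1) ?ltn_ord // => L.
  by rewrite /across forall_axes /coord.
- case: posnP => [K0|Kpos].
    apply: big1 => L; rewrite /across forall_axes /coord /= K0 andbC => /andP[].
    by [].
  rewrite (pred_at K.1 K.2.-1) ?ltn_ord ?(leq_ltn_trans (leq_pred _)) // => L.
  by rewrite /across forall_axes /coord /=; congr (_ && _);
    rewrite -[in LHS](prednK Kpos) eqSS eq_sym.
- rewrite (pred_at K.1.+1 K.2) ?ltn_ord ?andbT // => L.
  by rewrite /across forall_axes /coord.
- case: posnP => [K0|Kpos].
    by apply: big1 => L; rewrite /across forall_axes /coord /= K0 => /andP[].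
  rewrite (pred_at K.1.-1 K.2) ?ltn_ord ?andbT ?(leq_ltn_trans (leq_pred _)) // => L.
  by rewrite /across forall_axes /coord /=; congr (_ && _);
    rewrite -[in LHS](prednK Kpos) eqSS eq_sym.
Qed.

Lemma sum_neighbours K (g : side -> nat -> nat -> R) :
  \sum_(s : side) \sum_(L | across s K L) g s L.1 L.2 =
  ((if (0 < K.1)%N then g (ord0, false) K.1.-1 K.2 else 0)
   + (if (K.1.+1 < n)%N then g (ord0, true) K.1.+1 K.2 else 0))
  + ((if (0 < K.2)%N then g (axis1, false) K.1 K.2.-1 else 0)
   + (if (K.2.+1 < n)%N then g (axis1, true) K.1 K.2.+1 else 0)).
Proof. by rewrite sum_sides !sum_across. Qed.

Lemma sum_external K (g : side -> R) :
  \sum_(s : side | external s K) g s =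
  ((if (0 < K.1)%N then 0 else g (ord0, false))
   + (if (K.1.+1 < n)%N then 0 else g (ord0, true)))
  + ((if (0 < K.2)%N then 0 else g (axis1, false))
   + (if (K.2.+1 < n)%N then 0 else g (axis1, true))).
Proof.
have top (i : 'I_n) : (i.+1 == n) = ~~ (i.+1 < n)%N by have := ltn_ord i; lia.
rewrite big_mkcond sum_sides /external /coord /= !top !lt0n.
by rewrite !if_neg.
Qed.

Lemma on_cell v K : v K = on_grid v K.1 K.2.
Proof. by rewrite on_gridE; case: K. Qed.

Lemma neg_laplaceE v K :
  neg_laplace v K = (step R n ^+ 2)^-1 * lap2 n (on_grid v) K.1 K.2.
Proof.
rewrite /neg_laplace.
under eq_bigr => s _ do under eq_bigr => L _ do rewrite (on_cell v L).
rewrite (sum_neighbours K (fun _ i j => v K - on_grid v i j)) sum_external !on_cell.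
rewrite /lap2 /lap1 [2 / _]mulrC -mulrA -mulrDr; congr (_ * _).
by do 4![case: ifP => _]; ring.
Qed.

Lemma gradxE p K :
  grad p ord0 K = (step R n ^+ 2)^-1 * (step R n * gradx n (on_grid p) K.1 K.2).
Proof.
rewrite /grad.
under eq_bigr => s _ do under eq_bigr => L _ do rewrite (on_cell p L).
rewrite (sum_neighbours K (fun s i j => _ * ((p K + on_grid p i j) / 2) * normal R s ord0)).
rewrite sum_external !on_cell /normal /= -mulrDr; congr (_ * _).
rewrite /gradx /grad1.
by do 4![case: ifP => _]; field.
Qed.

Lemma gradyE p K :
  grad p axis1 K =
  (step R n ^+ 2)^-1 * (step R n * gradx n (transpose (on_grid p)) K.2 K.1).
Proof.
rewrite /grad.
under eq_bigr => s _ do under eq_bigr => L _ do rewrite (on_cell p L).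
rewrite (sum_neighbours K (fun s i j => _ * ((p K + on_grid p i j) / 2) * normal R s axis1)).
rewrite sum_external !on_cell /normal /= -mulrDr; congr (_ * _).
rewrite /gradx /grad1 /transpose.
by do 4![case: ifP => _]; field.
Qed.

Lemma divE u K :
  div u K = (step R n ^+ 2)^-1 *
  (step R n * (divx n (on_grid (u ord0)) K.1 K.2
             + divx n (transpose (on_grid (u axis1))) K.2 K.1)).
Proof.
rewrite /div; congr (_ * _).
under eq_bigr => s _ do under eq_bigr => L _ do
  rewrite sum_axes (on_cell (u ord0) L) (on_cell (u axis1) L).
rewrite (sum_neighbours K (fun s i j => _ *
   ((u ord0 K + on_grid (u ord0) i j) / 2 * normal R s ord0 +
    (u axis1 K + on_grid (u axis1) i j) / 2 * normal R s axis1))).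
rewrite !on_cell /normal /= /divx /div1 /transpose.
by do 4![case: ifP => _]; field.
Qed.

(** As n is even, both cells of a pair {2k, 2k+1} belong to the mesh. *)
Lemma neg_laplace_clusterE p K : ~~ odd n ->
  neg_laplace_cluster p K = (step R n ^+ 2)^-1 * cluster_lap (on_grid p) K.1 K.2.
Proof.
move=> even_n; rewrite /neg_laplace_cluster; congr (_ * _).
have -> : \sum_(s : side) \sum_(L | across s K L && same_cluster K L) (p K - p L) =
   \sum_(s : side) \sum_(L | across s K L)
    (if (K.1./2 == L.1./2) && (K.2./2 == L.2./2) then p K - on_grid p L.1 L.2 else 0).
  apply: eq_bigr => s _; rewrite big_mkcondr; apply: eq_bigr => L _.
  by rewrite (on_cell p L) /same_cluster forall_axes.
rewrite (sum_neighbours K (fun _ i j =>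
  if (K.1./2 == i./2) && (K.2./2 == j./2) then p K - on_grid p i j else 0)).
have line (i : 'I_n) (x y : R) :
   (if (0 < i)%N then (if i./2 == i.-1./2 then x else 0) else 0)
   + (if (i.+1 < n)%N then (if i./2 == i.+1./2 then y else 0) else 0)
   = if odd i then x else y.
  have im := ltn_ord i; case: (boolP (odd i)) => oi.
    have -> : (0 < i)%N by lia.
    have -> : i./2 == i.-1./2 by lia.
    have -> : (i./2 == i.+1./2) = false by lia.
    by rewrite if_same addr0.
  have -> : (i.+1 < n)%N by lia.
  have -> : i./2 == i.+1./2 by lia.
  case: posnP => i0; first by rewrite add0r.
  have -> : (i./2 == i.-1./2) = false by lia.
  by rewrite add0r.
rewrite !eqxx !andbT !andTb !line on_cell /cluster_lap /mate.
by case: ifP => _; case: ifP => _.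
Qed.

Lemma dirichlet1_cells (a : nat -> R) : (0 < n)%N -> dirichlet1 n a a =
  \sum_(i < n) ((if (i.+1 < n)%N then (a i - a i.+1) ^+ 2 else 0)
     + ((if (0 < i)%N then 0 else 2 * a i ^+ 2)
      + (if (i.+1 < n)%N then 0 else 2 * a i ^+ 2))).
Proof.
move=> n0; rewrite !big_split /= (sum_inner_right n (fun i => (a i - a i.+1) ^+ 2)).
rewrite (sum_first (fun i => 2 * a i ^+ 2) n0) (sum_last (fun i => 2 * a i ^+ 2) n0).
rewrite /dirichlet1 addrA -!mulrA -!expr2; congr (_ + _ + _); apply: eq_bigr => i _.
by rewrite -sqrrN opprB expr2.
Qed.

Lemma XT_normsqE v : (0 < n)%N -> XT_normsq v = dirichlet n (on_grid v) (on_grid v).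
Proof.
move=> n0; rewrite /dirichlet; under [X in _ = X + _]eq_bigr => j _ do rewrite dirichlet1_cells //.
under [X in _ = _ + X]eq_bigr => j _ do rewrite dirichlet1_cells //.
rewrite [X in _ = X + _]exchange_big -big_split /=.
under [RHS]eq_bigr => i _ do rewrite -big_split /=.
rewrite (pair_bigA _ (fun i j : 'I_n => _)) /XT_normsq -big_split /=.
apply: eq_bigr => K _.
under eq_bigr => d _ do under eq_bigr => L _ do rewrite (on_cell v L).
rewrite sum_axes !(sum_across K _ (fun i j => (v K - on_grid v i j) ^+ 2)) /=.
rewrite sum_external !on_cell.
by do 4![case: ifP => _]; ring.
Qed.

End Bridge.

(** * Well-posedness of the scheme with cell data *)

Section CellScheme.
Variables (R : realType) (lambda : R) (n : nat).
Hypotheses (lambda0 : 0 < lambda) (n0 : (0 < n)%N) (even_n : ~~ odd n).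
Let h : R := step R n.

Let hpos : 0 < h.
Proof. by rewrite /h /step invr_gt0 ltr0n. Qed.

Definition cell_scheme (F : 'I_2 -> cell n -> R) (u : XT2 R n) (p : XT R n) : Prop :=
  [/\ \sum_K p K = 0,
      forall K d, neg_laplace (u d) K + grad p d K = F d K
    & forall K, div u K + lambda * step R n ^+ 2 * neg_laplace_cluster p K = 0].

(** Multiplying the momentum balance by h^2, and the mass balance by h, removes the step. *)
Lemma cell_scheme_stokes F u p : cell_scheme F u p ->
  stokes_scheme lambda n (on_grid (u ord0)) (on_grid (u axis1))
    (fun i j => h * on_grid p i j)
    (fun i j => h ^+ 2 * on_grid (F ord0) i j) (fun i j => h ^+ 2 * on_grid (F axis1) i j).
Proof.
move=> [_ momentum mass] i j im jm; pose K : cell n := (Ordinal im, Ordinal jm).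
have h0 := lt0r_neq0 hpos.
have gridK (v : cell n -> R) : on_grid v i j = v K := on_gridE v (Ordinal im) (Ordinal jm).
have gradZ q k l : gradx n (fun i j => h * q i j) k l = h * gradx n q k l.
  by rewrite /gradx /grad1; case: ifP => _; case: ifP => _; field.
split.
- rewrite gridK -momentum neg_laplaceE gradxE gradZ -mulrDr mulrA mulfV ?mul1r //.
  by rewrite expf_neq0.
- have -> : transpose (fun i j => h * on_grid p i j) =
      (fun i j => h * transpose (on_grid p) i j) by [].
  rewrite gridK -momentum neg_laplaceE gradyE gradZ -mulrDr mulrA mulfV ?mul1r //.
  by rewrite expf_neq0.
- have := mass K; rewrite divE neg_laplace_clusterE // /cluster_lap -/h /=.
  set D := divx _ _ _ _ + divx _ _ _ _; set c := _ + (_ - _) => e.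
  have : h * (h^-1 * (D + lambda * (h * c))) = 0.
    by rewrite -[RHS](mulr0 h) -e; field.
  by rewrite mulVKf // => <-; rewrite /c; ring.
Qed.

Lemma sum_sqr_cells (v : cell n -> R) (k : R) :
  gsum n (fun i j => (k * on_grid v i j) ^+ 2) = k ^+ 2 * \sum_K v K ^+ 2.
Proof.
rewrite -sum_cells mulr_sumr; apply: eq_bigr => -[i j] _ /=.
by rewrite on_gridE exprMn.
Qed.

Lemma cell_scheme_stable F u p : cell_scheme F u p ->
  \sum_d XT_normsq (u d) + h ^+ 2 * \sum_K p K ^+ 2 <=
  stability_constant lambda * (h ^+ 2 * \sum_d \sum_K F d K ^+ 2).
Proof.
move=> sol; have eqs := cell_scheme_stokes sol; have [p0 _ _] := sol.
have P0 : gsum n (fun i j => h * on_grid p i j) = 0.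
  rewrite gsumZ -sum_cells (eq_bigr p) ?p0 ?mulr0 // => K _.
  by rewrite -on_cell.
have h0 := lt0r_neq0 hpos.
have nh : n%:R ^+ 2 = (h ^+ 2)^-1 by rewrite /h /step exprVn invrK.
rewrite !sum_axes !XT_normsqE // -sum_sqr_cells.
have -> : h ^+ 2 * (\sum_K F ord0 K ^+ 2 + \sum_K F axis1 K ^+ 2) =
   n%:R ^+ 2 * (gsum n (fun i j => (h ^+ 2 * on_grid (F ord0) i j) ^+ 2) +
       gsum n (fun i j => (h ^+ 2 * on_grid (F axis1) i j) ^+ 2)).
  by rewrite !sum_sqr_cells nh; field.
exact: stokes_stable.
Qed.

Definition dofs : finType := (('I_2 * cell n) + cell n)%type.
Definition velocity (x : dofs -> R) : XT2 R n := [ffun d => [ffun K => x (inl (d, K))]].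
Definition pressure (x : dofs -> R) : XT R n := [ffun K => x (inr K)].
Definition encode (u : XT2 R n) (p : XT R n) (k : dofs) : R :=
  match k with inl dK => u dK.1 dK.2 | inr K => p K end.
(** The mass equations add up to zero and the pressure is fixed up to a constant.  Adding
    the sum of the pressure to every mass equation makes the square system regular without
    changing its solutions: the sum of these equations gives back the zero mean. *)
Definition scheme_map (x : dofs -> R) (k : dofs) : R :=
  match k with
  | inl (d, K) => neg_laplace (velocity x d) K + grad (pressure x) d K
  | inr K => div (velocity x) K
      + lambda * step R n ^+ 2 * neg_laplace_cluster (pressure x) K
      + \sum_L pressure x L
  end.
Definition scheme_data (F : 'I_2 -> cell n -> R) (k : dofs) : R :=
  match k with inl (d, K) => F d K | inr _ => 0 end.

Lemma velocity_encode u p : velocity (encode u p) = u.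
Proof. by apply/ffunP => d; apply/ffunP => K; rewrite !ffunE. Qed.

Lemma pressure_encode u p : pressure (encode u p) = p.
Proof. by apply/ffunP => K; rewrite !ffunE. Qed.

Lemma sum_mass (u : XT2 R n) (p : XT R n) :
  \sum_(K : cell n) (div u K + lambda * step R n ^+ 2 * neg_laplace_cluster p K) = 0.
Proof.
have nE : n = (n./2).*2 by rewrite -[LHS]odd_double_half (negbTE even_n).
rewrite big_split /=; under eq_bigr do rewrite divE.
under [X in _ + X]eq_bigr do rewrite neg_laplace_clusterE //.
have div0 v : gsum n (divx n v) = 0.
  have := gsum_gradx (fun _ _ => 1) v n0.
  rewrite [in RHS](eq_gsum (g := divx n v)) => [e|i j _ _]; last by rewrite mul1r.
  apply/eqP; rewrite -oppr_eq0 -e.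
  apply/eqP; apply: big1 => i _; apply: big1 => j _.
  by rewrite /gradx /grad1 subrr !mul0r !if_same addr0 mul0r.
have cl0 q : gsum n (cluster_lap q) = 0 :> R.
  rewrite nE gsum_block; apply: big1 => i _; apply: big1 => j _.
  by rewrite /cluster_lap /mate /= !odd_double /=; ring.
rewrite -!mulr_sumr (sum_cells n (cluster_lap (on_grid p))) cl0 !mulr0 addr0.
rewrite (sum_cells n (fun i j => divx n (on_grid (u ord0)) i j
  + divx n (transpose (on_grid (u axis1))) j i)) gsumD div0.
by rewrite (gsum_transpose n (divx n (transpose (on_grid (u axis1))))) div0 addr0 !mulr0.
Qed.

Lemma scheme_mapP F u p :
  scheme_map (encode u p) =1 scheme_data F <-> cell_scheme F u p.
Proof.
rewrite /scheme_map velocity_encode pressure_encode; split=> [e|[p0 h1 h2]]; last first.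
  by case=> [[d K]|K] /=; rewrite ?h1 // h2 p0 addr0.
have mass K := e (inr K).
have p0 : \sum_K p K = 0.
  have : \sum_(K : cell n) (div u K + lambda * step R n ^+ 2 * neg_laplace_cluster p K
     + \sum_L p L) = 0 by apply: big1 => K _; exact: mass.
  rewrite big_split /= sum_mass add0r sumr_const card_prod card_ord => /eqP.
  by rewrite mulrn_eq0 muln_eq0 orbb (gtn_eqF n0) => /eqP.
split=> // [K d|K]; first exact: (e (inl (d, K))).
by have := mass K; rewrite p0 addr0.
Qed.

Lemma on_grid_velocity (x : dofs -> R) d :
  on_grid (velocity x d) = on_grid (fun K => x (inl (d, K))).
Proof.
by do 2![apply/funext => ?]; apply: eq_on_grid => K; rewrite !ffunE.
Qed.

Lemma on_grid_pressure (x : dofs -> R) :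
  on_grid (pressure x) = on_grid (fun K => x (inr K)).
Proof. by do 2![apply/funext => ?]; apply: eq_on_grid => K; rewrite !ffunE. Qed.

Lemma scheme_map_linear k x y i :
  scheme_map (fun j => k * x j + y j) i = k * scheme_map x i + scheme_map y i.
Proof.
have vlin d a b : on_grid (velocity (fun j => k * x j + y j) d) a b =
    k * on_grid (velocity x d) a b + on_grid (velocity y d) a b.
  by rewrite !on_grid_velocity (on_grid_lin k (fun K => x (inl (d, K)))).
have plin a b : on_grid (pressure (fun j => k * x j + y j)) a b =
    k * on_grid (pressure x) a b + on_grid (pressure y) a b.
  by rewrite !on_grid_pressure (on_grid_lin k (fun K => x (inr K))).
case: i => [[d K]|K] /=.
  case: (unliftP ord0 d) => [e ->|->]; rewrite ?(ord1 e) -?/axis1 !neg_laplaceE.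
    rewrite !gradyE /lap2 /lap1 /gradx /grad1 /transpose !vlin !plin.
    by do 4![case: ifP => _]; ring.
  rewrite !gradxE /lap2 /lap1 /gradx /grad1 !vlin !plin.
  by do 4![case: ifP => _]; ring.
have -> : \sum_L pressure (fun j => k * x j + y j) L =
    k * \sum_L pressure x L + \sum_L pressure y L.
  by rewrite mulr_sumr -big_split; apply: eq_bigr => L _; rewrite !ffunE.
rewrite !divE !neg_laplace_clusterE // /cluster_lap /divx /div1 /transpose !vlin !plin.
by do 4![case: ifP => _]; ring.
Qed.

Lemma eq_scheme_map x y : x =1 y -> scheme_map x =1 scheme_map y.
Proof. by move=> /funext ->. Qed.

(** Zero data force a zero solution by the a priori estimate. *)
Lemma scheme_map_injective x : scheme_map x =1 (fun=> 0) -> x =1 (fun=> 0).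
Proof.
have xE : x = encode (velocity x) (pressure x).
  by apply/funext => -[[d K]|K]; rewrite /= !ffunE.
rewrite {1}xE => e.
have sol : cell_scheme (fun _ _ => 0) (velocity x) (pressure x).
  by apply/scheme_mapP => k; rewrite e; case: k => [[]|].
have := cell_scheme_stable sol.
have -> : \sum_(d : 'I_2) \sum_(K : cell n) (0 : R) ^+ 2 = 0.
  by apply: big1 => d _; apply: big1 => K _; rewrite expr0n.
rewrite !mulr0 sum_axes !XT_normsqE // => le0.
have h2 : 0 < h ^+ 2 by rewrite exprn_gt0.
have p2 : 0 <= \sum_K pressure x K ^+ 2 by apply: sumr_ge0 => K _; apply: sqr_ge0.
have a0 w : 0 <= dirichlet n w w :> R.
  by rewrite /dirichlet addr_ge0 // sumr_ge0 // => *; exact: dirichlet1_ge0.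
have hp : 0 <= h ^+ 2 * \sum_K pressure x K ^+ 2 by rewrite mulr_ge0 // ltW.
have zero (v : cell n -> R) : \sum_K v K ^+ 2 <= 0 -> forall K, v K = 0.
  move=> v0 K; have : \sum_K v K ^+ 2 = 0.
    by apply/eqP; rewrite eq_le v0 sumr_ge0 // => L _; apply: sqr_ge0.
  move/eqP; rewrite psumr_eq0 => [/allP/(_ K)|L _]; last exact: sqr_ge0.
  by rewrite mem_index_enum sqrf_eq0 => /(_ isT)/eqP.
have vzero d : dirichlet n (on_grid (velocity x d)) (on_grid (velocity x d)) <= 0 ->
    forall K, velocity x d K = 0.
  move=> ad; apply: zero; have := sum_sqr_cells (velocity x d) 1.
  rewrite expr1n mul1r => <-; under eq_gsum do rewrite mul1r.
  apply: le_trans (poincare2 _ n0) _.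
  by rewrite pmulr_rle0 // exprn_gt0 // ltr0n.
have a1 := a0 (on_grid (velocity x ord0)); have a2 := a0 (on_grid (velocity x axis1)).
case=> [[d K]|K].
  have -> : x (inl (d, K)) = velocity x d K by rewrite !ffunE.
  apply: vzero; case: (unliftP ord0 d) => [l ->|->]; rewrite ?(ord1 l) -?/axis1; lra.
have -> : x (inr K) = pressure x K by rewrite !ffunE.
apply: zero; rewrite -(pmulr_rle0 _ h2); lra.
Qed.

Lemma cell_scheme_exists F : exists u p, cell_scheme F u p.
Proof.
have [x xP] := linear_injective_surjective eq_scheme_map scheme_map_linear
  scheme_map_injective (scheme_data F).
exists (velocity x), (pressure x); apply/scheme_mapP.
have <- // : x = encode (velocity x) (pressure x).
by apply/funext => -[[d K]|K]; rewrite /= !ffunE.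
Qed.

Lemma cell_scheme_unique F u p u' p' :
  cell_scheme F u p -> cell_scheme F u' p' -> u = u' /\ p = p'.
Proof.
move=> /scheme_mapP e /scheme_mapP e'.
have d0 : (fun k => -1 * encode u p k + encode u' p' k) =1 (fun=> 0).
  by apply: scheme_map_injective => k; rewrite scheme_map_linear e e' mulN1r addNr.
have ee k : encode u p k = encode u' p' k by have := d0 k; lra.
split; [apply/ffunP => d|]; apply/ffunP => K.
  exact: (ee (inl (d, K))).
exact: (ee (inr K)).
Qed.

End CellScheme.

(** * Integrals of cellwise constant functions *)

Section RintegralSum.
Context d (T : measurableType d) (R : realType) (mu : {measure set T -> \bar R}).

Lemma Rintegral_sum (I : finType) (D : set T) (f : I -> T -> R) :
  measurable D -> (forall i, mu.-integrable D (EFin \o f i)) ->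
  \int[mu]_(x in D) (\sum_i f i x) = \sum_i \int[mu]_(x in D) f i x.
Proof.
move=> mD intf; rewrite /Rintegral.
under eq_integral => x _ do rewrite -sumEFin.
rewrite (integral_sum mD (fun i => intf i)) -sum_fine // => i _.
by apply: integrable_fin_num => //; apply: intf.
Qed.

End RintegralSum.

Section Measure.
Variables (R : realType).
Local Notation mu := (leb2 R).

(** Holds without integrability: both sides are 0 if the integral is infinite. *)
Lemma L2normE (f : R * R -> R) :
  L2norm f = Num.sqrt (\int[mu]_x (f \_ (Omega R)) x ^+ 2).
Proof.
rewrite /L2norm unlock /Rintegral; set g : R * R -> R := f \_ (Omega R).
have -> : (\int[mu]_x (`|(EFin \o g) x| `^ 2) = \int[mu]_x (g x ^+ 2)%:E)%E.
  apply: eq_integral => x _.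
  by rewrite /= powR_mulrn // real_normK // num_real.
have : (0 <= \int[mu]_x (g x ^+ 2)%:E)%E.
  by apply: integral_ge0 => x _; rewrite lee_fin sqr_ge0.
case: (\int[mu]_x _)%E => [r|_|//]; last by rewrite poweRyr ?invr_eq0 //= sqrtr0.
by rewrite lee_fin => r0; rewrite /= powR12_sqrt.
Qed.

Lemma L2norm_sqr (f : R * R -> R) :
  L2norm f ^+ 2 = \int[mu]_x (f \_ (Omega R)) x ^+ 2.
Proof.
by rewrite L2normE sqr_sqrtr // Rintegral_ge0 // => x _; apply: sqr_ge0.
Qed.

Variable n : nat.
Hypothesis n0 : (0 < n)%N.
Let h : R := step R n.

Let hpos : 0 < h.
Proof. by rewrite /h /step invr_gt0 ltr0n. Qed.

Lemma measurable_cell (K : cell n) :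
  measurable (cell_set R K : set (measurableTypeR R * measurableTypeR R)).
Proof. by apply: measurableX; apply: measurable_itv. Qed.

Lemma mu_cell (K : cell n) : mu (cell_set R K) = (h ^+ 2)%:E.
Proof.
have side (k : nat) : lebesgue_measure `](k%:R * h), (k.+1%:R * h)[%classic = h%:E.
  rewrite lebesgue_measure_itv /= lte_fin ltr_pM2r // ltr_nat ltnS leqnn.
  by rewrite -EFinB -mulrBl -natr1 addrAC subrr add0r mul1r.
rewrite /cell_set /= (_ : (h ^+ 2)%:E = (h%:E * h%:E)%E); last by rewrite -EFinM expr2.
rewrite -{1}(side K.1) -(side K.2).
by apply: product_measure1E; apply: measurable_itv.
Qed.

Lemma cell_sub_Omega (K : cell n) : cell_set R K `<=` Omega R.
Proof.
have side (k : 'I_n) (t : R) : k%:R * h < t < k.+1%:R * h -> 0 < t < 1.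
  move=> /andP[kt tk]; apply/andP; split.
    by apply: le_lt_trans kt; rewrite mulr_ge0 // ltW.
  apply: lt_le_trans tk _; rewrite /h /step ler_pdivrMr ?ltr0n // mul1r ler_nat.
  exact: ltn_ord.
by move=> x [] /=; rewrite !in_itv /= => h1 h2; split; rewrite /= in_itv /=;
   apply: side; eassumption.
Qed.

Lemma cell_disjoint (K L : cell n) x : cell_set R K x -> cell_set R L x -> K = L.
Proof.
have side (k l : 'I_n) (t : R) : k%:R * h < t < k.+1%:R * h ->
    l%:R * h < t < l.+1%:R * h -> k = l.
  move=> /andP[k1 k2] /andP[l1 l2]; apply/val_inj/eqP => /=.
  have := lt_trans k1 l2; have := lt_trans l1 k2.
  by rewrite !ltr_pM2r // !ltr_nat !ltnS eqn_leq => -> ->.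
case: K L => [k k'] [l l'] [] /=; rewrite !in_itv /= => K1 K2 [] /=.
by rewrite !in_itv /= => L1 L2; rewrite (side _ _ _ K1 L1) (side _ _ _ K2 L2).
Qed.

Lemma integrable_cell_cst (K : cell n) (r : R) :
  mu.-integrable (cell_set R K) (EFin \o cst r).
Proof.
apply: measurable_bounded_integrable; first exact: measurable_cell.
- by rewrite mu_cell ltry.
- exact: measurable_cst.
- exact: bounded_cst.
Qed.

Lemma integrable_cell (K : cell n) (w : R) :
  mu.-integrable setT (EFin \o (fun x => w * \1_(cell_set R K) x)).
Proof.
have mK := measurable_cell K.
have -> : EFin \o (fun x => w * \1_(cell_set R K) x) = (EFin \o cst w) \_ (cell_set R K).
  apply/funext => x; rewrite patchE /= indicE.
  by case: ifP => _; rewrite ?mulr1 ?mulr0.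
apply/integrable_restrict => //; rewrite setTI; exact: integrable_cell_cst.
Qed.

Lemma fun_of_XT_out (v : XT R n) x : ~ Omega R x -> fun_of_XT v x = 0.
Proof.
move=> out; rewrite /fun_of_XT big1 // => K _.
rewrite indicE memNset ?mulr0 // => xK; apply: out; exact: cell_sub_Omega xK.
Qed.

Lemma fun_of_XT_restrict (v : XT R n) : fun_of_XT v \_ (Omega R) = fun_of_XT v.
Proof.
apply/funext => x; rewrite patchE; case: ifPn => // /negP out.
by rewrite fun_of_XT_out // => xO; apply: out; rewrite inE.
Qed.

Lemma fun_of_XT_in (v : XT R n) K x : cell_set R K x -> fun_of_XT v x = v K.
Proof.
move=> xK; rewrite /fun_of_XT (bigD1 K) //= indicE mem_set // mulr1.
rewrite big1 ?addr0 // => L LK; rewrite indicE memNset ?mulr0 // => xL.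
by rewrite (cell_disjoint xL xK) eqxx in LK.
Qed.

Lemma fun_of_XT_sqr (v : XT R n) x :
  fun_of_XT v x ^+ 2 = \sum_(K : cell n) v K ^+ 2 * \1_(cell_set R K) x.
Proof.
have [[K xK]|out] := pselect (exists K : cell n, cell_set R K x).
  have := @fun_of_XT_in [ffun K => v K ^+ 2] K x xK.
  rewrite (fun_of_XT_in v xK) ffunE => <-.
  by apply: eq_bigr => L _; rewrite ffunE.
rewrite /fun_of_XT !big1 ?expr0n // => K _; rewrite indicE memNset ?mulr0 // => xK;
  by apply: out; exists K.
Qed.

Lemma Rintegral_cells (w : cell n -> R) :
  \int[mu]_x (\sum_(K : cell n) w K * \1_(cell_set R K) x) = h ^+ 2 * \sum_K w K.
Proof.
rewrite Rintegral_sum // => [|K]; last exact: integrable_cell.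
rewrite mulr_sumr; apply: eq_bigr => K _.
have i1 : mu.-integrable setT (EFin \o \1_(cell_set R K)).
  by apply: eq_integrable (integrable_cell K 1) => // x _; rewrite /= mul1r.
rewrite (RintegralZl _ measurableT i1) mulrC; congr (_ * _).
rewrite /Rintegral integral_indic ?setIT ?mu_cell //.
  exact: measurable_cell.
Qed.

Lemma L2norm_XT (v : XT R n) : L2norm (fun_of_XT v) ^+ 2 = h ^+ 2 * \sum_K v K ^+ 2.
Proof.
rewrite L2norm_sqr fun_of_XT_restrict -Rintegral_cells.
by apply: eq_Rintegral => x _; exact: fun_of_XT_sqr.
Qed.

Lemma zero_meanE (p : XT R n) : zero_mean p <-> \sum_K p K = 0.
Proof.
have h2 : h ^+ 2 != 0 by rewrite expf_neq0 // lt0r_neq0.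
rewrite /zero_mean Rintegral_mkcond fun_of_XT_restrict Rintegral_cells.
split=> [/eqP|->]; last by rewrite mulr0.
by rewrite mulf_eq0 (negbTE h2) => /eqP.
Qed.

(** Cauchy-Schwarz on each cell: with c the mean of f, integrate 2 c f - c^2 <= f^2. *)
Lemma cell_mean_le (f : R * R -> R) : in_L2 f ->
  h ^+ 2 * \sum_(K : cell n) cell_mean f K ^+ 2 <= L2norm f ^+ 2.
Proof.
move=> fL2; rewrite L2norm_sqr; set g : R * R -> R := f \_ (Omega R).
have mg : measurable_fun (setT : set (measurableTypeR R * measurableTypeR R)) g.
  by move: fL2; rewrite /in_L2 inE => /andP[]; rewrite inE.
have ig2 : mu.-integrable setT (EFin \o (fun x => g x ^+ 2)) by exact: Lfun2_integrable_sqr.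
pose c (K : cell n) := cell_mean f K.
pose phi (K : cell n) : R * R -> R := (fun x => 2 * c K * g x - c K ^+ 2) \_ (cell_set R K).
have igK (K : cell n) : mu.-integrable (cell_set R K) (EFin \o g).
  have mK := measurable_cell K.
  have i2 : mu.-integrable (cell_set R K) (EFin \o (fun x => 1 + g x ^+ 2)).
    have ig2K := integrableS measurableT mK (@subsetT _ _) ig2.
    exact: (integrableD mK (integrable_cell_cst K 1) ig2K).
  apply: le_integrable i2 => //.
    by apply/measurable_realfun.measurable_EFinP; apply: measurable_funS mg.
  move=> x _ /=; rewrite lee_fin.
  rewrite [leRHS]ger0_norm ?addr_ge0 ?sqr_ge0 //.
  have := sqr_ge0 (`|g x| - 2^-1); have := real_normK (num_real (g x)).
  by nra.
have iphiK (K : cell n) :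
    mu.-integrable (cell_set R K) (EFin \o (fun x => 2 * c K * g x - c K ^+ 2)).
  have mK := measurable_cell K.
  exact: (integrableB mK (integrableZl mK (2 * c K) (igK K)) (integrable_cell_cst K (c K ^+ 2))).
have iphi (K : cell n) : mu.-integrable setT (EFin \o phi K).
  have mK := measurable_cell K.
  rewrite /phi -restrict_EFin; apply/integrable_restrict => //.
  by rewrite setTI; exact: iphiK.
have phiE (K : cell n) : \int[mu]_x phi K x = h ^+ 2 * c K ^+ 2.
  have mK := measurable_cell K.
  rewrite /phi -Rintegral_mkcond.
  have -> : \int[mu]_(x in cell_set R K) (2 * c K * g x - c K ^+ 2) =
      \int[mu]_(x in cell_set R K) (2 * c K * g x) - \int[mu]_(x in cell_set R K) (c K ^+ 2).
    apply: RintegralB => //; last exact: integrable_cell_cst.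
    exact: (integrableZl mK (2 * c K) (igK K)).
  have -> : \int[mu]_(x in cell_set R K) (2 * c K * g x) =
      2 * c K * \int[mu]_(x in cell_set R K) g x by exact: RintegralZl.
  have -> : \int[mu]_(x in cell_set R K) (c K ^+ 2) = c K ^+ 2 * h ^+ 2.
    by rewrite Rintegral_cst // mu_cell.
  have -> : \int[mu]_(x in cell_set R K) g x = h ^+ 2 * c K.
    rewrite /c /cell_mean mulVKf ?expf_neq0 ?lt0r_neq0 //.
    apply: eq_Rintegral => x; rewrite inE => xK.
    by rewrite /g patchE mem_set //; exact: cell_sub_Omega xK.
  by ring.
rewrite mulr_sumr; under eq_bigr do rewrite -phiE.
rewrite -Rintegral_sum //; apply: le_Rintegral => //.
  have isum : mu.-integrable setT (fun x => \sum_K (EFin \o phi K) x)%E.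
    by apply: integrable_sum => // K _; exact: iphi.
  by apply: eq_integrable isum => // x _; rewrite /= -sumEFin.
move=> x _.
have [[K xK]|out] := pselect (exists K : cell n, cell_set R K x).
  rewrite (bigD1 K) //= big1 ?addr0 => [|L LK]; last first.
    rewrite /phi patchE memNset // => xL.
    by rewrite (cell_disjoint xL xK) eqxx in LK.
  by rewrite /phi patchE mem_set //; have := sqr_ge0 (g x - c K); lra.
rewrite big1 ?sqr_ge0 // => K _; rewrite /phi patchE memNset // => xK.
by apply: out; exists K.
Qed.

End Measure.

(** * Conclusion *)

Lemma discrete_solutionE (R : realType) (lambda : R) (n : nat)
    (f : 'I_2 -> R * R -> R) (u : XT2 R n) (p : XT R n) : (0 < n)%N ->
  discrete_solution lambda f u p <->
  cell_scheme lambda (fun d K => cell_mean (f d) K) u p.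
Proof.
by move=> n0; have [h1 h2] := zero_meanE n0 p; split=> -[m e1 e2]; split=> //; auto.
Qed.

Lemma stability_constant_ge0 (R : realFieldType) (lambda : R) :
  0 < lambda -> 0 <= stability_constant lambda.
Proof.
move=> l0; have : 0 < (2 * lambda)^-1 by rewrite invr_gt0 mulr_gt0.
by rewrite /stability_constant => ?; nra.
Qed.

Theorem theorem2p5 (R : realType) (lambda : R) (lambda_gt0 : 0 < lambda) :
  (forall (n : nat) (f : 'I_2 -> R * R -> R),
     (0 < n)%N -> ~~ odd n -> (forall d : 'I_2, in_L2 (f d)) ->
     exists! up : XT2 R n * XT R n, discrete_solution lambda f up.1 up.2)
  /\
  (exists c : R,
     forall (n : nat) (f : 'I_2 -> R * R -> R) (u : XT2 R n) (p : XT R n),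
       (0 < n)%N -> ~~ odd n -> (forall d : 'I_2, in_L2 (f d)) ->
       discrete_solution lambda f u p ->
       XT2_norm u + L2norm (fun_of_XT p) <= c * L2norm2 f).
Proof.
split=> [n f n0 even_n _|].
  have [u [p sol]] :=
    cell_scheme_exists lambda_gt0 n0 even_n (fun d K => cell_mean (f d) K).
  exists (u, p); split=> [|[u' p'] /(discrete_solutionE _ _ _ _ n0) sol'].
    by apply/discrete_solutionE.
  by have [-> ->] := cell_scheme_unique lambda_gt0 n0 even_n sol sol'.
exists (2 * Num.sqrt (stability_constant lambda)) => n f u p n0 even_n fL2.
move=> /(discrete_solutionE _ _ _ _ n0) sol.
have bound := cell_scheme_stable lambda_gt0 n0 even_n sol.
have C0 := stability_constant_ge0 lambda_gt0.
have data : step R n ^+ 2 * \sum_d \sum_(K : cell n) cell_mean (f d) K ^+ 2 <=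
    \sum_d L2norm (f d) ^+ 2.
  by rewrite mulr_sumr; apply: ler_sum => d _; apply: cell_mean_le.
have u0 : 0 <= \sum_d XT_normsq (u d).
  apply: sumr_ge0 => d _; rewrite XT_normsqE //.
  by rewrite /dirichlet addr_ge0 // sumr_ge0 // => *; exact: dirichlet1_ge0.
rewrite -L2norm_XT // in bound.
have total := le_trans bound (ler_wpM2l C0 data).
rewrite -mulrA -sqrtrM // -/(L2norm2 f) mulrDl mul1r.
have p0 : 0 <= L2norm (fun_of_XT p) by rewrite L2normE sqrtr_ge0.
apply: lerD.
  apply: ler_wsqrtr; apply: le_trans total; rewrite lerDl; exact: sqr_ge0.
rewrite -(ger0_norm p0) -sqrtr_sqr; apply: ler_wsqrtr.
by apply: le_trans total; rewrite lerDr.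
Qed.
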